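(* If $G$ is a planar graph with maximum degree $\Delta\geq 7$ and without $5$-cycles (i.e. with no cycle of length $5$ as a subgraph), then $\chi'_{gl}(G)\leq \Delta+1$.
   Context: All graphs are finite and simple. $\ell(G)$ denotes the line graph of $G$ (its vertices are the edges of $G$, two being adjacent iff they share an endpoint in $G$). Let $H$ be a graph with a fixed orientation of its edges, $A$ an Abelian group, $L:V(H)\to 2^A$ a list assignment and $f:E(H)\to A$. An $(A,L,f)$-coloring of $H$ is a map $c:V(H)\to A$ with $c(v)\in L(v)$ for every vertex $v$ and $c(x)-c(y)\neq f(xy)$ for every edge $xy$ directed from $x$ to $y$. $H$ is $(A,L)$-colorable if it has an $(A,L,f)$-coloring for every $f:E(H)\to A$ (this does not depend on the orientation). $H$ is $k$-group choosable if it is $(A,L)$-colorable for every Abelian group $A$ of order at least $k$ and every $L$ with $|L(v)|=k$ for all $v\in V(H)$. $\chi_{gl}(H)$ is the smallest $k$ such that $H$ is $k$-group choosable. $\chi'_{gl}(G)=\chi_{gl}(\ell(G))$. *)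

(* Defs.v *)
From HB Require Import structures.
From mathcomp Require Import all_boot all_order all_algebra finmap.
From mathcomp Require Import mathcomp_extra boolp classical_sets functions.
From mathcomp Require Import cardinality set_interval reals topology normedtype.

Set Implicit Arguments.
Unset Strict Implicit.
Unset Printing Implicit Defensive.

Import Order.TTheory GRing.Theory Num.Theory.
Import numFieldNormedType.Exports.

Record sgraph := SGraph {
  vertex :> finType;
  adj : rel vertex;
  adj_sym : symmetric adj;
  adj_irrefl : irreflexive adj }.

Arguments adj {s} _ _ : rename.

Definition max_degree (G : sgraph) : nat :=
  \max_(x : G) #|[pred y | adj x y]|.

Definition edge_set (G : sgraph) : {set {set G}} :=
  [set [set p.1; p.2]%SET | p in [pred p : G * G | adj p.1 p.2]]%SET.

Definition edge (G : sgraph) : finType := {e : {set G} | e \in edge_set G}.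

Definition line_adj (G : sgraph) : rel (edge G) :=
  fun e e' => (e != e') && ~~ [disjoint val e & val e'].

Lemma line_adj_sym (G : sgraph) : symmetric (@line_adj G).
Proof. by move=> e e'; rewrite /line_adj eq_sym disjoint_sym. Qed.

Lemma line_adj_irrefl (G : sgraph) : irreflexive (@line_adj G).
Proof. by move=> e; rewrite /line_adj eqxx. Qed.

Definition line_graph (G : sgraph) : sgraph :=
  SGraph (@line_adj_sym G) (@line_adj_irrefl G).

(** Planarity: existence of a drawing in the real plane whose edges are
    (arbitrary continuous) simple arcs meeting only at common end vertices *)

Section Planarity.
Local Open Scope classical_set_scope.
Local Open Scope ring_scope.

(* [p x] is the point representing the vertex [x] and [g e] is an arc,
   parametrized by [0, 1], representing the edge [e]; the values of [g e]
   outside of [0, 1] are irrelevant. *)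
Record plane_drawing (R : realType) (G : sgraph)
    (p : G -> R * R) (g : edge G -> R -> R * R) : Prop := PlaneDrawing {
  drawing_vertex_inj : injective p;
  drawing_arc_continuous :
    forall e, {within `[0, 1], continuous (g e)};
  drawing_arc_inj :
    forall e, {in `[0, 1] &, injective (g e)};
  drawing_arc_ends : forall e, exists x y : G,
    [/\ val e = [set x; y]%SET, g e 0 = p x & g e 1 = p y];
  drawing_arc_vertex : forall e (x : G) (t : R),
    t \in `]0, 1[ -> g e t <> p x;
  drawing_arc_disjoint : forall e e' (t t' : R), e != e' ->
    t \in `]0, 1[ -> t' \in `]0, 1[ -> g e t <> g e' t' }.

Definition planar (R : realType) (G : sgraph) : Prop :=
  exists p g, @plane_drawing R G p g.

End Planarity.

Section GroupColoring.
Local Open Scope classical_set_scope.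
Local Open Scope card_scope.
Local Open Scope ring_scope.

Definition orientation (H : sgraph) (o : rel H) : Prop :=
  (forall x y, adj x y = o x y || o y x) /\
  (forall x y, ~~ (o x y && o y x)).

Definition group_coloring (H : sgraph) (o : rel H) (A : zmodType)
    (L : H -> set A) (f : edge H -> A) (c : H -> A) : Prop :=
  (forall v, L v (c v)) /\
  (forall (e : edge H) x y,
     val e = [set x; y]%SET -> o x y -> c x - c y <> f e).

Definition group_colorable (H : sgraph) (A : zmodType) (L : H -> set A)
    : Prop :=
  forall o : rel H, orientation o ->
  forall f : edge H -> A, exists c, group_coloring o L f c.

(* The group [A] may be infinite. *)
Definition group_choosable (H : sgraph) (k : nat) : Prop :=
  forall A : zmodType, [set: A] #>= `I_k ->
  forall L : H -> set A, (forall v, L v #= `I_k) -> group_colorable L.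

(* The greedy argument: it shows that the minimum defining [chi_gl] exists. *)
Lemma group_choosable_card (H : sgraph) : group_choosable H #|H|.
Proof.
move=> A _ L cardL o [oadj oN] f.
have finL v : finite_set (L v) by apply/finite_setP; exists #|H|.
have extend v (s : seq A) : (size s < #|H|)%N -> exists2 a, L v a & a \notin s.
  move=> sH; have [/allP Ls|] := boolP (all (mem s) (fset_set (L v))).
    have := uniq_leq_size (fset_uniq (fset_set (L v))) Ls.
    by rewrite (card_fset_set (cardL v)) leqNgt sH.
  by case/allPn => a; rewrite in_fset_set// inE => La as_; exists a.
suff [c [cL cP]] : exists c : H -> A, (forall v, L v (c v)) /\
    (forall (e : edge H) x y, x \in enum H -> y \in enum H ->
       val e = [set x; y]%SET -> o x y -> c x - c y <> f e).
  by exists c; split=> // e x y; apply: cP; rewrite mem_enum.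
have := enum_uniq H; have : (size (enum H) <= #|H|)%N by rewrite cardE.
elim: (enum H) => [_ _|v s IHs /= sH /andP[vs us]].
  have Lne v : exists a, L v a.
    have /(extend v [::])[a La _] : (0 < #|H|)%N by apply/card_gt0P; exists v.
    by exists a.
  by have [c cL] := choice Lne; exists c.
have [c [cL cP]] := IHs (ltnW sH) us.
pose bad u := if insub [set v; u]%SET is Some e
  then if o v u then f e + c u else c u - f e else 0.
have [|a La aNbad] := extend v (map bad s); first by rewrite size_map.
have badE (e : edge H) u : val e = [set v; u]%SET ->
    bad u = if o v u then f e + c u else c u - f e.
  by move=> vue; rewrite /bad -vue valK.
have irr x : o x x = false.
  by apply/negbTE; have := oadj x x; rewrite adj_irrefl orbb => <-.
have sv x : x \in s -> (x == v) = false.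
  by move=> xs; apply: contraNF vs => /eqP <-.
exists (fun u => if u == v then a else c u); split=> [u|e x y].
  by case: eqP => [->|_].
rewrite !inE; case: (eqVneq x v) => [->|xv] /=.
  case: (eqVneq y v) => [->|yv] /=; first by rewrite irr.
  move=> _ ys eE ovy ace; move/negP: aNbad; apply; apply/mapP; exists y => //.
  by rewrite (badE e)// ovy -ace subrK.
case: (eqVneq y v) => [->|yv] /=; last exact: cP.
move=> xs _ eE oxv ace; move/negP: aNbad; apply; apply/mapP; exists x => //.
have /negbTE ovx : ~~ o v x by have := oN x v; rewrite oxv.
have eE' : val e = [set v; x]%SET by rewrite finset.setUC.
by rewrite (badE e)// ovx -ace opprB addrC subrK.
Qed.

Lemma group_choosable_ex (H : sgraph) : exists k, `[< group_choosable H k >].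
Proof. by exists #|H|; apply/asboolP/group_choosable_card. Qed.

Definition chi_gl (H : sgraph) : nat := ex_minn (group_choosable_ex H).

Definition chi'_gl (G : sgraph) : nat := chi_gl (line_graph G).

End GroupColoring.

(* Main.v *)
Require Import Defs.
From mathcomp Require Import all_boot zify reals.
From mathcomp Require all_order all_algebra finmap lra boolp classical_sets.
From mathcomp Require cardinality prodnormedzmodule topology normedtype.

(** Write D for the maximum degree.  If every nonempty set S of edges contains an
    edge uv with deg_S(u) + deg_S(v) <= D + 2, then that edge meets at most D
    other edges of S; so the line graph is D-degenerate and its vertices can be
    coloured one at a time from lists of size D + 1, because a coloured
    neighbour forbids a single element of the group
    ([degenerate_group_choosable]).  The content is thus the existence of such
    an edge ([light_edge]).

    Suppose that all edges of S have degree sum at least D + 3 >= 10.  Pass to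
    an end block: a set of edges without cut vertices in which all vertices but
    one, the root, keep all their edges ([cohesive_core]).  Give charge d - 4 to
    a vertex of degree d and l - 4 to a face of length l; by Euler's formula the
    total is at most -8.  Without 5-cycles the faces are triangles, quadrilaterals, or
    have length at least 6, and a triangle shares an edge with a quadrilateral
    only at a root of degree 2.  A long face can give 1/3 through each of its
    edges, which pays for the edges of triangles that face it.  What remains are
    the edges with a triangle on both sides, called spines below, which need
    2/3, and the vertices of degree 3, which need 1.  A spine has an end that is
    the root or has degree at least 5, which pays; a vertex of degree 3 receives
    1/3 from each neighbour, which is the root or has degree D.  The absence of 5-cycles keeps the
    spines at a vertex apart, so that a vertex of degree d meets at most d/3 of
    them, and as D >= 7 every vertex but the root can afford what it pays.  The
    debt around the root is less than 8: contradiction ([discharge]).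

    Planarity is used only through an abstract dual in the sense of Whitney: a
    graph on a finite set of faces, with the same edges, whose cuts are the even
    sets of edges.  Euler's formula is then a count of dimensions
    ([euler_dual]), and the connectedness of the link of a vertex
    ([link_connected]) plays the role of the cyclic order of its edges.

    To get a dual from a drawing by arbitrary continuous arcs, cut each arc into
    three parts.  Disjoint parts are at positive distance, so on a fine enough
    square lattice the parts can be followed by lattice paths that meet only if
    the parts do ([arcs_on_lattice]).  This exhibits the graph as a minor of the
    lattice ([arcs_dual]).  In the lattice the even sets of edges are visibly the
    boundaries of sets of squares, and merging the squares that no path
    separates yields the dual of the minor ([grid_dual]). *)

Set Implicit Arguments.
Unset Strict Implicit.
Unset Printing Implicit Defensive.

(** * Even edge sets *)

Ltac neqs := repeat match goal with
  | H : is_true (?a != ?b) |- context [?a == ?b] => rewrite (negbTE H)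
  | H : is_true (?a != ?b) |- context [?b == ?a] =>
      rewrite (eq_sym b a) (negbTE H)
  end; rewrite ?andbF ?orbF ?eqxx //=.

Section Parity.

Lemma xor_card (I : finType) (A P : pred I) :
  \big[addb/false]_(i | A i) P i = odd #|[set i | A i && P i]|.
Proof.
rewrite -sum1_card (big_morph odd oddD (erefl _)) big_mkcond [RHS]big_mkcond /=.
by apply: eq_bigr => i _; rewrite inE; case: (A i); case: (P i).
Qed.

Lemma xor_delta (I : finType) (P F : pred I) (i0 : I) :
  \big[addb/false]_(i | P i) ((i == i0) && F i) = P i0 && F i0.
Proof.
rewrite big_mkcond (bigD1 i0) //= eqxx big1 ?addbF => [|i /negbTE ->].
  by case: (P i0).
by case: ifP.
Qed.

End Parity.

Section EdgeSets.
Variable T : finType.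
Implicit Types (S X Y Z : {set {set T}}) (e f : {set T}) (u v x y a : T).

Definition simple S := forall e, e \in S -> #|e| = 2.

Lemma edge_end S e v : simple S -> e \in S -> v \in e ->
  exists2 u, u != v & e = [set v; u].
Proof.
move=> sS eS; have /eqP/cards2P[a [b [ab ->]]] := sS e eS.
rewrite !inE => /orP[] /eqP ->; first by exists b; rewrite // eq_sym.
by exists a; rewrite // setUC.
Qed.

Lemma edge_ends S e : simple S -> e \in S ->
  exists u v, u != v /\ e = [set u; v].
Proof. by move=> sS eS; apply/cards2P; rewrite sS. Qed.

Lemma in_pair a x v : a != x -> (v \in [set a; x]) = (v == a) (+) (v == x).
Proof.
by move=> ax; rewrite !inE; case: eqP => //= ->; rewrite (negbTE ax).
Qed.

Lemma pair_neq a b x y : a \notin [set x; y] -> [set a; b] != [set x; y].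
Proof. by apply: contraNneq => <-; rewrite set21. Qed.

Lemma pair_inj v a b : [set v; a] = [set v; b] -> a = b.
Proof.
move=> E; have := set22 v a; rewrite E !inE => /orP[] /eqP // av.
by have := set22 v b; rewrite -E !inE av orbb => /eqP.
Qed.

Lemma pair_eqE a b x y : ([set a; b] == [set x; y]) =
  (a == x) && (b == y) || (a == y) && (b == x).
Proof.
apply/eqP/orP => [E|[] /andP[/eqP-> /eqP->] //]; last by rewrite setUC.
have := set21 a b; rewrite E !inE => /orP[] /eqP aE.
  by left; move: E; rewrite aE eqxx => /pair_inj ->; rewrite eqxx.
by right; move: E; rewrite aE eqxx [RHS]setUC => /pair_inj ->; rewrite eqxx.
Qed.

Definition deg S v := #|[set e in S | v \in e]|.

Definition even_set Y := forall v, ~~ odd (deg Y v).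

Lemma even_next Y e v : even_set Y -> e \in Y -> v \in e ->
  exists2 f, f \in Y & (v \in f) && (f != e).
Proof.
move=> evY eY ve; have := evY v; rewrite /deg (cardsD1 e) !inE eY ve /= negbK => o.
have /card_gt0P[f] : 0 < #|[set e in Y | v \in e] :\ e| by case: #|_| o.
by rewrite !inE => /and3P[fe fY vf]; exists f; rewrite // vf fe.
Qed.

Lemma even_step Y a x : simple Y -> even_set Y -> [set a; x] \in Y ->
  exists2 p, [set x; p] \in Y & (p != a) && (p != x).
Proof.
move=> sY evY axY; have [f fY /andP[xf fax]] := even_next evY axY (set22 a x).
have [p px fE] := edge_end sY fY xf; exists p; first by rewrite -fE.
by rewrite px andbT; apply: contraNneq fax => <-; rewrite fE setUC.
Qed.

Lemma deg_setD Y Z v : Z \subset Y -> deg (Y :\: Z) v = deg Y v - deg Z v.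
Proof.
move=> ZY; rewrite /deg -(cardsID [set e in Z | v \in e] [set e in Y | v \in e]).
have -> : [set e in Y | v \in e] :&: [set e in Z | v \in e] =
          [set e in Z | v \in e].
  apply/setP => e; rewrite !inE; case: (boolP (e \in Z)) => eZ; rewrite ?andbF //=.
  by rewrite (subsetP ZY _ eZ) andbb.
rewrite addKn; apply: eq_card => e; rewrite !inE.
by case: (e \in Y); case: (e \in Z); case: (v \in e).
Qed.

Lemma even_setD Y Z : Z \subset Y -> even_set Y -> even_set Z ->
  even_set (Y :\: Z).
Proof.
move=> ZY evY evZ v; rewrite deg_setD // oddB ?negb_add ?(negbTE (evY v)) ?(negbTE (evZ v)) //.
by apply: subset_leq_card; apply/subsetP=> e; rewrite !inE => /andP[/(subsetP ZY)->].
Qed.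

(** Following an edge at both of its ends gives two further edges, which
    differ because the graph is simple. *)
Lemma even_card_ge3 Y : simple Y -> even_set Y -> Y != set0 -> 2 < #|Y|.
Proof.
move=> sY evY /set0Pn[e eY]; have [a [x [ax eE]]] := edge_ends sY eY.
have axY : [set a; x] \in Y by rewrite -eE.
have [p xpY /andP[pa px]] := even_step sY evY axY.
have xaY : [set x; a] \in Y by rewrite setUC.
have [r arY /andP[rx ra]] := even_step sY evY xaY.
have /subset_leq_card : [set [set a; x]; [set x; p]; [set a; r]] \subset Y.
  by rewrite !subUset !sub1set axY xpY arY.
apply: leq_trans; rewrite -setUA !cardsU1 !inE cards1 /=.
rewrite negb_or.
have -> : [set a; x] != [set x; p].
  by apply: pair_neq; rewrite !inE negb_or ax eq_sym.
have -> : [set a; x] != [set a; r] by apply: contraNneq rx => /pair_inj ->.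
suff -> : [set x; p] != [set a; r] by [].
by apply: pair_neq; rewrite !inE negb_or eq_sym ax eq_sym.
Qed.

Lemma xor_deg Y v : odd (deg Y v) = \big[addb/false]_(e in Y) (v \in e).
Proof. by rewrite xor_card. Qed.

Lemma even_triangle a x p : a != x -> x != p -> p != a ->
  even_set [set [set a; x]; [set x; p]; [set p; a]] /\
  #|[set [set a; x]; [set x; p]; [set p; a]]| = 3.
Proof.
move=> ax xp pa.
have e1 : [set a; x] \notin [set [set x; p]; [set p; a]].
  by rewrite !inE !pair_eqE; neqs.
have e2 : [set x; p] != [set p; a] by rewrite !pair_eqE; neqs.
split; last by rewrite -setUA cardsU1 e1 cards2 e2.
move=> v; rewrite xor_deg -setUA (big_setU1 _ e1) /= big_setU1 ?in_set1 //=.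
rewrite big_set1 !in_pair //.
by case: (v == a); case: (v == x); case: (v == p).
Qed.

Lemma even_quad a x p r : uniq [:: a; x; p; r] ->
  even_set [set [set a; x]; [set x; p]; [set p; r]; [set r; a]] /\
  #|[set [set a; x]; [set x; p]; [set p; r]; [set r; a]]| = 4.
Proof.
rewrite /= !inE !negb_or !andbT => /andP[/and3P[ax ap ar] /andP[/andP[xp xr] pr]].
have e1 : [set a; x] \notin [set [set x; p]; [set p; r]; [set r; a]].
  by rewrite !inE !pair_eqE; neqs.
have e2 : [set x; p] \notin [set [set p; r]; [set r; a]].
  by rewrite !inE !pair_eqE; neqs.
have e3 : [set p; r] != [set r; a] by rewrite !pair_eqE; neqs.
rewrite -setUA in e1.
split; last by rewrite -!setUA cardsU1 e1 cardsU1 e2 cards2 e3.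
move=> v; rewrite xor_deg -!setUA (big_setU1 _ e1) /= (big_setU1 _ e2) /=.
rewrite big_setU1 ?in_set1 //= big_set1 !in_pair //; last by rewrite eq_sym.
by case: (v == a); case: (v == x); case: (v == p); case: (v == r).
Qed.

(** An even set with at most five edges is a single cycle: it contains a cycle
    of length 3, 4 or 5, and what is left is even with at most two edges. *)
Lemma small_even Y a x : simple Y -> even_set Y -> #|Y| <= 5 ->
  [set a; x] \in Y ->
  [\/ exists p, [/\ #|Y| = 3, p \notin [set a; x] &
        Y = [set [set a; x]; [set x; p]; [set p; a]]],
      exists p r, [/\ #|Y| = 4, uniq [:: a; x; p; r] &
        Y = [set [set a; x]; [set x; p]; [set p; r]; [set r; a]]] |
      exists p q r, [/\ #|Y| = 5, uniq [:: a; x; p; q; r] &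
        [/\ [set x; p] \in Y, [set p; q] \in Y, [set q; r] \in Y &
            [set r; a] \in Y]]].
Proof.
move=> sY evY cY axY.
have ax : a != x.
  by apply/eqP => ax; have := sY _ axY; rewrite ax setUid cards1.
(* The rest of Y is even with at most two edges, hence empty. *)
have sub Z : Z \subset Y -> even_set Z -> 2 < #|Z| -> Y = Z.
  move=> ZY evZ cZ; apply/eqP; rewrite eqEsubset ZY andbT -setD_eq0.
  apply: contraTT isT => /even_card_ge3 -/(_ _ (even_setD ZY evY evZ)).
  have sD : simple (Y :\: Z) by move=> e; rewrite inE => /andP[_ /sY].
  by move=> /(_ sD); rewrite cardsD (setIidPr ZY); lia.
have [p xpY /andP[pa px]] := even_step sY evY axY.
have xaY : [set x; a] \in Y by rewrite setUC.
have [r arY /andP[rx ra]] := even_step sY evY xaY.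
have raY : [set r; a] \in Y by rewrite setUC.
have tri q : [set q; a] \in Y -> [set x; q] \in Y -> q != a -> q != x ->
    Y = [set [set a; x]; [set x; q]; [set q; a]] /\ #|Y| = 3.
  move=> qaY xqY qa qx; have [|ev c3] := even_triangle ax _ qa; first by rewrite eq_sym.
  have YE : Y = [set [set a; x]; [set x; q]; [set q; a]].
    by apply: sub; rewrite ?c3 // !subUset !sub1set axY xqY qaY.
  by split; rewrite // YE c3.
have [prE|pr] := eqVneq p r.
  have [|YE c3] := tri p _ xpY pa px; first by rewrite prE.
  by constructor 1; exists p; rewrite c3 !inE negb_or pa px.
have [q pqY /andP[qx qp]] := even_step sY evY xpY.
have [qrE|qr] := eqVneq q r.
  have U : uniq [:: a; x; p; r].
    by rewrite /= !inE !negb_or ax pr ![a == _]eq_sym pa ra ![x == _]eq_sym px rx.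
  have [ev c4] := even_quad U; constructor 2; exists p, r.
  have YE : Y = [set [set a; x]; [set x; p]; [set p; r]; [set r; a]].
    by apply: sub; rewrite ?c4 // !subUset !sub1set axY xpY raY -qrE pqY.
  by rewrite {1}YE c4.
have pqr : [set p; q] \notin [set [set a; x]; [set x; p]; [set a; r]].
  by rewrite !inE !pair_eqE; neqs.
have [qaE|qa] := eqVneq q a.
  have [|YE c3] := tri p _ xpY pa px; first by rewrite -qaE.
  have := pqr; rewrite qaE; move: arY; rewrite YE !inE !pair_eqE.
  by neqs.
have [z rzY /andP[za zr]] := even_step sY evY arY.
have c4 : #|[set [set p; q]; [set a; x]; [set x; p]; [set a; r]]| = 4.
  by rewrite -!setUA !cardsU1 cards1 !inE !pair_eqE; neqs.
have rzN : [set r; z] \notin [set [set p; q]; [set a; x]; [set x; p]; [set a; r]].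
  by rewrite !inE !pair_eqE; neqs.
have c5 : #|[set r; z] |: [set [set p; q]; [set a; x]; [set x; p]; [set a; r]]| = 5.
  by rewrite cardsU1 rzN c4.
have YE : Y = [set r; z] |: [set [set p; q]; [set a; x]; [set x; p]; [set a; r]].
  apply/esym/eqP; rewrite eqEcard c5 cY andbT.
  by rewrite !subUset !sub1set rzY pqY axY xpY arY.
have [f fY /andP[qf fpq]] := even_next evY pqY (set22 p q).
have : f \in Y by []; rewrite {1}YE !inE (negbTE fpq) /=.
case/orP=> [/eqP fE|]; last first.
  by case/orP=> [/orP[]|] /eqP fE; move: qf; rewrite fE !inE; neqs.
move: qf; rewrite fE !inE (negbTE qr) /= => /eqP qz.
constructor 3; exists p, q, r; rewrite xpY pqY setUC raY qz rzY YE c5; split=> //.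
by rewrite -qz /= !inE; neqs.
Qed.

End EdgeSets.

(** * Cores without cut vertices *)

Section Cohesion.
Variable T : finType.
Implicit Types (S X Y Z : {set {set T}}) (e f : {set T}) (u v x y a c : T).

(** Connectedness after deletion of any one vertex x, phrased on edges: a
    nonempty set of edges closed under adjacency at the vertices other than x
    is everything. *)
Definition cohesive S := forall x S1, S1 \subset S -> S1 != set0 ->
  (forall e1 e2 v, e1 \in S1 -> e2 \in S -> v != x -> v \in e1 -> v \in e2 ->
     e2 \in S1) -> S1 = S.

(** The root c stands for the cut vertex of an end block. *)
Definition rooted S S' c := [forall v, (v != c) ==>
  [forall e in S, forall e' in S', (v \in e) ==> (v \in e') ==> (e \in S')]].

Lemma rootedP S S' c :
  reflect (forall v e e', v != c -> e \in S -> e' \in S' -> v \in e -> v \in e' ->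
             e \in S') (rooted S S' c).
Proof.
apply: (iffP forallP) => [H v e e' vc eS eS' ve ve'|H v].
  have /implyP/(_ vc)/forall_inP/(_ e eS)/forall_inP/(_ e' eS') := H v.
  by rewrite ve ve'.
apply/implyP => vc; apply/forall_inP => e eS; apply/forall_inP => e' eS'.
by apply/implyP => ve; apply/implyP => ve'; exact: H vc eS eS' ve ve'.
Qed.

(** A minimal nonempty rooted subset works: if a vertex x cut it in two, one
    of the parts would be rooted at x.  This is an end block of the graph. *)
Lemma cohesive_core S : simple S -> S != set0 ->
  exists S' c, [/\ S' \subset S, S' != set0, rooted S S' c & cohesive S'].
Proof.
move=> sS S0; have /set0Pn[e0 e0S] := S0.
have [a [b [_ _]]] := edge_ends sS e0S.
pose P X := [&& X != set0, X \subset S & [exists c, rooted S X c]].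
have PS : P S.
  rewrite /P S0 subxx; apply/existsP; exists a; apply/rootedP => v e e' _ eS *.
  exact: eS.
have [S' /minsetP[/and3P[S'0 S'S /existsP[c rS']] minS'] _] := minset_exists PS.
exists S', c; split=> // x S1 S1S S10 share.
have PI Y : Y \subset S' -> Y != set0 -> rooted S Y x -> S' = Y.
  move=> YS Y0 rY; apply/esym/minS' => //; apply/and3P; split=> //.
    exact: subset_trans S'S.
  by apply/existsP; exists x.
(* If c is a vertex of S1 other than x, then it is not one of the rest of S',
   and that rest is rooted at x; otherwise S1 is. *)
have [c1|] := boolP ((c == x) || (c \notin cover S1)).
  apply/esym/PI => //; apply/rootedP => v e e' vx eS e'S1 ve ve'.
  have e'S' := subsetP S1S _ e'S1.
  apply: (share e' e v) => //; apply: (rootedP _ _ _ rS' v e e') => //.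
  case/orP: c1 => [/eqP -> //|]; apply: contraNneq => <-.
  by apply/bigcupP; exists e'.
rewrite negb_or negbK => /andP[cx /bigcupP[e1 e1S1 ce1]].
apply/eqP; rewrite eqEsubset S1S -setD_eq0; apply: contraT => S2.
have S2E : S' = S' :\: S1.
  apply: PI S2 _; first exact: subsetDl.
  apply/rootedP => v e e' vx eS; rewrite !inE => /andP[e'N e'S'] ve ve'.
  have vc : v != c.
    by apply: contraNneq e'N => vE; apply: (share e1 e' v); rewrite // vE ce1.
  have eS' := rootedP _ _ _ rS' _ _ _ vc eS e'S' ve ve'.
  by rewrite eS' andbT; apply: contra e'N => eS1; apply: (share e e' v).
have := subsetP S1S _ e1S1; rewrite S2E inE e1S1 //.
Qed.

(** * Abstract duals and Euler's formula *)

(** The boundary modulo 2 of a set of edges, given by its indicator z. *)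
Definition odd_at S (z : {set T} -> bool) v := \big[addb/false]_(e in S | v \in e) z e.

(** In the multigraph on F that joins [s1 e] and [s2 e] for each e in S, the
    function w is a set of vertices and the right-hand side its cut; so this is
    an abstract dual in the sense of Whitney. *)
Definition dual S (F : finType) (s1 s2 : {set T} -> F) := forall z,
  (forall v, odd_at S z v = false) <->
  exists w : F -> bool, {in S, forall e, z e = w (s1 e) (+) w (s2 e)}.

Lemma odd_atD S z1 z2 v :
  odd_at S (fun e => z1 e (+) z2 e) v = odd_at S z1 v (+) odd_at S z2 v.
Proof. exact: big_split. Qed.

Lemma odd_at1 S e0 v : e0 \in S -> odd_at S (pred1 e0) v = (v \in e0).
Proof.
move=> e0S; rewrite /odd_at; under eq_bigr do rewrite -[pred1 _ _]andbT.
by rewrite xor_delta e0S andbT.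
Qed.

Lemma eq_odd_at S z1 z2 v : {in S, z1 =1 z2} -> odd_at S z1 v = odd_at S z2 v.
Proof. by move=> E; apply: eq_bigr => e /andP[/E]. Qed.

Lemma odd_at_even S Y : Y \subset S -> (forall v, odd_at S (mem Y) v = false) <-> even_set Y.
Proof.
move=> YS; have E v : odd_at S (mem Y) v = odd (deg Y v).
  rewrite /odd_at xor_card /deg; congr odd; apply: eq_card => e; rewrite !inE.
  by case: (boolP (e \in Y)) => [/(subsetP YS) ->|]; rewrite ?andbF ?andbT.
by split=> H v; [rewrite -E H | rewrite E; apply/negbTE].
Qed.

Section Dual.
Variables (S : {set {set T}}) (F : finType) (s1 s2 : {set T} -> F).
Hypotheses (sS : simple S) (cS : cohesive S) (dS : dual S s1 s2).

(** The link of x in the faces is connected.  By hypothesis X meets every cut of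
    the dual evenly, that is, every even set; but a walk avoiding x from an edge
    of X to an edge at x outside X would close up to an even set that meets X
    oddly, and cohesion provides such a walk. *)
Lemma link_connected x X : X != set0 -> X \subset [set e in S | x \in e] ->
  (forall w : F -> bool, \big[addb/false]_(e in X) (w (s1 e) (+) w (s2 e)) = false) ->
  X = [set e in S | x \in e].
Proof.
move=> X0 XS evX; apply/eqP; rewrite eqEsubset XS; apply/subsetP => f.
rewrite inE => /andP[fS xf]; apply: contraT => fX.
have XSP e : e \in X -> e \in S /\ x \in e.
  by move/(subsetP XS); rewrite inE => /andP.
(* Chains from x to y that meet X oddly. *)
pose reach y := [exists W : {set {set T}},
  [forall v, odd_at S (mem W) v == (v == x) (+) (v == y)] &&
  \big[addb/false]_(e in X) (e \in W)].
have reachI (z : pred {set T}) y : (forall v, odd_at S z v = (v == x) (+) (v == y)) ->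
    \big[addb/false]_(e in X) z e -> reach y.
  move=> bz oz; apply/existsP; exists [set e | z e]; apply/andP; split.
    apply/forallP => v; rewrite -bz; apply/eqP/eq_odd_at => e _ /=.
    by rewrite inE.
  by under eq_bigr do rewrite inE.
have reachE y : reach y -> exists2 z : pred {set T},
    forall v, odd_at S z v = (v == x) (+) (v == y) & \big[addb/false]_(e in X) z e.
  case/existsP=> W /andP[/forallP H1 H2]; exists (mem W) => // v.
  by apply/eqP/H1.
have x1 z e0 : \big[addb/false]_(e in X) (z e (+) (e == e0)) =
    \big[addb/false]_(e in X) z e (+) (e0 \in X).
  rewrite big_split /=; congr addb; under eq_bigr do rewrite -[_ == _]andbT.
  by rewrite xor_delta andbT.
(* The edges joined to X without passing through x: by cohesion, all of S. *)
pose S1 := [set e in S | [exists y in e, (y != x) && reach y]].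
have S1P e : reflect (e \in S /\ exists y, [/\ y \in e, y != x & reach y]) (e \in S1).
  rewrite inE; apply: (iffP andP) => -[eS]; last first.
    by case=> y [ye yx ry]; split=> //; apply/existsP; exists y; rewrite ye yx.
  by case/existsP=> y /and3P[ye yx ry]; split=> //; exists y.
have E : S1 = S.
  apply: (cS (x := x)).
  - by apply/subsetP => e /S1P[].
  - have /set0Pn[e0 e0X] := X0; apply/set0Pn; exists e0; apply/S1P.
    have [e0S xe0] := XSP _ e0X; split=> //.
    have [y yx e0E] := edge_end sS e0S xe0; exists y; split=> //.
      by rewrite e0E set22.
    apply: (reachI (pred1 e0)) => [v|]; first by rewrite odd_at1 // e0E in_pair // eq_sym.
    by have := x1 pred0 e0; rewrite big1_eq e0X /= => ->.
  move=> e1 e2 v /S1P[e1S [y [ye1 yx ry]]] e2S vx ve1 ve2.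
  apply/S1P; split=> //; exists v; split=> //.
  have [<- //|yv] := eqVneq y v.
  have e1E : e1 = [set y; v].
    have [u uy e1E] := edge_end sS e1S ye1; move: ve1.
    by rewrite e1E !inE eq_sym (negbTE yv) => /eqP ->.
  have e1X : e1 \notin X.
    apply/negP => /XSP[_]; rewrite e1E !inE ![x == _]eq_sym.
    by rewrite (negbTE yx) (negbTE vx).
  have [z bz oz] := reachE _ ry.
  apply: (reachI (fun e => z e (+) (e == e1))) => [u|]; last first.
    by rewrite x1 oz (negbTE e1X).
  rewrite odd_atD bz odd_at1 // e1E in_pair //.
  by case: (u == x); case: (u == y); case: (u == v).
have /S1P[_ [y [yf yx ry]]] : f \in S1 by rewrite E.
have fE : f = [set x; y].
  have [u ux fE] := edge_end sS fS xf; move: yf; rewrite fE !inE (negbTE yx).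
  by move/eqP ->.
have [z bz oz] := reachE _ ry.
have [w wE] : exists w : F -> bool,
    {in S, forall e, z e (+) (e == f) = w (s1 e) (+) w (s2 e)}.
  apply/dS => v; rewrite odd_atD bz odd_at1 // fE in_pair; last by rewrite eq_sym.
  by case: (v == x); case: (v == y).
have := evX w; rewrite (eq_bigr (fun e => z e (+) (e == f))); last first.
  by move=> e /XSP[eS _]; rewrite wE.
by rewrite x1 oz (negbTE fX).
Qed.

(** The boundary of the face p.  An edge with p on both sides is a bridge and
    does not belong to it. *)
Definition rim (p : F) := [set e in S | (s1 e == p) (+) (s2 e == p)].

(** A face boundary is the cut around a single vertex of the dual. *)
Lemma rim_even p : even_set (rim p).
Proof.
have bS : rim p \subset S by apply/subsetP => e; rewrite inE => /andP[].
apply/(odd_at_even bS) => v; move: v; apply/dS; exists (fun q => q == p) => e eS.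
by rewrite /= inE eS.
Qed.

Lemma rim_simple p : simple (rim p).
Proof. by move=> e; rewrite inE => /andP[/sS]. Qed.

Lemma rimP e p : e \in S -> s1 e != s2 e ->
  (e \in rim p) = (s1 e == p) || (s2 e == p).
Proof.
move=> eS ne; rewrite inE eS /=; case: eqP => //= <-.
by rewrite eq_sym (negbTE ne).
Qed.

Lemma rimN e p : e \in rim p -> e \in S /\ s1 e != s2 e.
Proof.
rewrite inE => /andP[eS H]; split=> //; apply: contraTneq H => ->.
by rewrite addbb.
Qed.

Lemma rim_w e p q (w : F -> bool) : e \in rim p -> e \in rim q -> p != q ->
  w (s1 e) (+) w (s2 e) = w p (+) w q.
Proof.
move=> ep eq pq; have [eS ne] := rimN ep.
move: ep eq; rewrite !rimP // => /orP[] /eqP E1 /orP[] /eqP E2.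
- by rewrite -E1 E2 eqxx in pq.
- by rewrite E1 E2.
- by rewrite E1 E2 addbC.
- by rewrite -E1 E2 eqxx in pq.
Qed.

Definition verts := [set v | 0 < deg S v].
Definition faces := [set p | rim p != set0].

Lemma handshake (z : {set T} -> bool) : \big[addb/false]_v odd_at S z v = false.
Proof.
rewrite /odd_at (exchange_big_dep (mem S)) /=; last by move=> v e _ /andP[].
rewrite big1 // => e eS.
under eq_bigl => v do rewrite eS.
under eq_bigr => v _ do rewrite -[z e]andbT.
case: (z e) => /=; last by rewrite big1.
by rewrite xor_card; under eq_finset do rewrite andbT; rewrite cardsE sS.
Qed.

Lemma odd_at_verts (z : {set T} -> bool) v : v \notin verts -> odd_at S z v = false.
Proof.
rewrite inE -leqNgt leqn0 cards_eq0 => /eqP E; rewrite /odd_at big_pred0 // => e.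
by have := in_set0 e; rewrite -E inE.
Qed.

(** The even subsets of S form a space of dimension at least
    |S| - (|verts| - 1), the kernel of the boundary map, and of dimension at most
    |faces| - 1, as cuts of the dual.  Both counts are packed in one injection
    of the subsets of S into pairs of a set of vertices and a set of faces. *)
Lemma euler_dual v0 p0 : v0 \in verts -> p0 \in faces ->
  #|S| + 2 <= #|verts| + #|faces|.
Proof.
move=> v0V p0F.
(* By the handshake lemma the boundary at v0 is determined by the others. *)
pose odds X := [set v in verts :\ v0 | odd_at S (mem X) v].
(* A fixed set with a given boundary; it differs from any other by an even set. *)
pose rep A := odflt set0 [pick Y in powerset S | odds Y == A].
(* Complementing a set of faces does not change its cut, so p0 may be left out. *)
pose cut (K : {set {set T}}) := odflt set0 [pick w : {set F} | (w \subset faces :\ p0) &&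
  [forall e in S, (e \in K) == (s1 e \in w) (+) (s2 e \in w)]].
pose sd X Y := [set e in S | (e \in X) (+) (e \in Y)].
pose J X := (odds X, cut (sd X (rep (odds X)))).
have repP X : X \subset S -> rep (odds X) \subset S /\ odds (rep (odds X)) = odds X.
  move=> XS; rewrite /rep; case: pickP => [Y /andP[]|/(_ X)] /=.
    by rewrite inE => ? /eqP.
  by rewrite inE XS eqxx.
have sdP X Y : odds X = odds Y -> forall v, odd_at S (mem (sd X Y)) v = false.
  move=> E.
  have out v : v != v0 -> odd_at S (mem (sd X Y)) v = false.
    move=> vv0; have [vV|] := boolP (v \in verts); last exact: odd_at_verts.
    rewrite (@eq_odd_at _ _ (fun e => (e \in X) (+) (e \in Y))); last first.
      by move=> e eS /=; rewrite inE eS.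
    move: vV; rewrite inE => vV.
    have := congr1 (fun A : {set T} => v \in A) E; rewrite !inE vv0 vV /=.
    by rewrite odd_atD => ->; rewrite addbb.
  move=> v; have [->|/out //] := eqVneq v v0.
  by have := handshake (mem (sd X Y)); rewrite (bigD1 v0) //= big1 ?addbF.
have cutP X Y : odds X = odds Y ->
    {in S, forall e, (e \in X) (+) (e \in Y) =
      (s1 e \in cut (sd X Y)) (+) (s2 e \in cut (sd X Y))}.
  move=> E e eS; rewrite /cut; case: pickP => /= [W /andP[_ /forall_inP/(_ e eS)/eqP <-]|].
    by rewrite inE eS.
  have [w wE] : exists w : F -> bool,
      {in S, forall e, (e \in sd X Y) = w (s1 e) (+) w (s2 e)}.
    exact/dS/sdP.
  pose W := [set p in faces | w p (+) w p0].
  move/(_ W)/negP; case; apply/andP; split.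
    by apply/subsetP => p; rewrite !inE => /andP[-> H]; rewrite andbT; apply: contraTneq H => ->; rewrite addbb.
  apply/forall_inP => f fS; apply/eqP; rewrite wE //.
  have [E12|ne] := eqVneq (s1 f) (s2 f); first by rewrite E12 !addbb.
  have f1 : s1 f \in faces.
    by rewrite inE; apply/set0Pn; exists f; rewrite rimP // eqxx.
  have f2 : s2 f \in faces.
    by rewrite inE; apply/set0Pn; exists f; rewrite rimP // eqxx orbT.
  rewrite !(in_set (fun p => (p \in faces) && (w p (+) w p0))) f1 f2 /=.
  by case: (w (s1 f)); case: (w (s2 f)); case: (w p0).
have injJ : {in powerset S &, injective J}.
  move=> X Y; rewrite !powersetE => XS YS [E1]; rewrite -E1 => E2.
  have [rS rE] := repP X XS.
  have cX := cutP X _ (esym rE); have cY := cutP Y _ (etrans (esym E1) (esym rE)).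
  apply/setP => e; have [eS|eN] := boolP (e \in S); last first.
    by rewrite (contraNF (subsetP XS e) eN) (contraNF (subsetP YS e) eN).
  by apply: (@addIb (e \in rep (odds X))); rewrite cX // cY // E2.
have J_sub : J @: powerset S \subset
    setX (powerset (verts :\ v0)) (powerset (faces :\ p0)).
  apply/subsetP => _ /imsetP[X _ ->]; rewrite in_setX !powersetE; apply/andP; split.
    by apply/subsetP => v; rewrite inE => /andP[].
  by rewrite /cut; case: pickP => /= [W /andP[]|_] //; exact: sub0set.
have := subset_leq_card J_sub; rewrite card_in_imset // cardsX !card_powerset.
rewrite -expnD leq_exp2l // (cardsD1 v0 verts) v0V (cardsD1 p0 faces) p0F; lia.
Qed.

End Dual.
End Cohesion.

(** * Discharging *)

Section Discharging.
Variable T : finType.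
Implicit Types (X Y Z : {set {set T}}) (e f : {set T}) (u v x y a : T).
Variables (S : {set {set T}}) (F : finType) (s1 s2 : {set T} -> F).
Variables (c : T) (D : nat).
Hypotheses (sS : simple S) (cS : cohesive S) (dS : dual S s1 s2).
Hypothesis D7 : 7 <= D.
(* The root c may have lost edges, so the bounds on degrees exempt it. *)
Hypothesis deg3 : forall v, v \in verts S -> v != c -> 3 <= deg S v.
Hypothesis deg_sum : forall u v, u != c -> v != c -> [set u; v] \in S ->
  D + 3 <= deg S u + deg S v.
Hypothesis degD : forall v, v != c -> deg S v <= D.
Hypothesis noC5 : forall a x p q r, uniq [:: a; x; p; q; r] ->
  [set a; x] \in S -> [set x; p] \in S -> [set p; q] \in S -> [set q; r] \in S ->
  [set r; a] \in S -> False.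
Implicit Types (p q : F).

Notation bd := (rim S s1 s2).
Notation st v := [set e in S | v \in e].

Lemma bdS p e : e \in bd p -> e \in S.
Proof. by case/rimN. Qed.

Lemma bd_small p a x : #|bd p| <= 5 -> [set a; x] \in bd p ->
  [\/ exists y, [/\ #|bd p| = 3, y \notin [set a; x] &
        bd p = [set [set a; x]; [set x; y]; [set y; a]]] |
      exists y z, [/\ #|bd p| = 4, uniq [:: a; x; y; z] &
        bd p = [set [set a; x]; [set x; y]; [set y; z]; [set z; a]]]].
Proof.
move=> le5 ax; have sb : simple (bd p) by exact: rim_simple.
have [||[y [z [t [_ U [xy yz zt ta]]]]]] := small_even sb (rim_even dS p) le5 ax.
- by constructor 1.
- by constructor 2.
- by case: (noC5 U (bdS ax) (bdS xy) (bdS yz) (bdS zt) (bdS ta)).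
Qed.

Lemma face_size p : p \in faces S s1 s2 ->
  [\/ #|bd p| = 3, #|bd p| = 4 | 6 <= #|bd p|].
Proof.
rewrite inE => b0; have [|le5] := ltnP 5 #|bd p|; first by constructor 3.
have /set0Pn[e eb] := b0; have [a [x [_ eE]]] := edge_ends sS (bdS eb).
rewrite eE in eb; case: (bd_small le5 eb) => [[y []]|[y [z []]]]; by [constructor 1|constructor 2].
Qed.

Lemma triangle p v a : #|bd p| = 3 -> [set v; a] \in bd p ->
  exists x, [/\ x != v, x != a, v != a &
    bd p = [set [set v; a]; [set a; x]; [set x; v]]].
Proof.
move=> c3 va; case: (@bd_small p v a) => [|//|[x [_]]|[y [z []]]]; rewrite ?c3 //.
rewrite !inE negb_or => /andP[xv xa] E; exists x; split=> //.
by apply/eqP => vaE; have := sS (bdS va); rewrite vaE setUid cards1.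
Qed.

(** Two faces that share two edges at v close up the link of v. *)
Lemma share2 p q v e f : p != q -> e != f -> v \in e -> v \in f ->
  e \in bd p -> e \in bd q -> f \in bd p -> f \in bd q -> deg S v = 2.
Proof.
move=> pq ef ve vf ep eq fp fq.
rewrite /deg; suff <- : [set e; f] = st v by rewrite cards2 ef.
apply: (link_connected sS cS dS).
- by apply/set0Pn; exists e; rewrite set21.
- by rewrite subUset !sub1set !inE ve vf (bdS ep) (bdS fp).
move=> w; rewrite big_setU1 ?inE //= big_set1.
by rewrite (rim_w w ep eq pq) (rim_w w fp fq pq) addbb.
Qed.

(** Vertices other than the root have degree at least 3. *)
Lemma deg2_root v e : v \in e -> e \in S -> deg S v = 2 -> v = c.
Proof.
move=> ve eS d2; apply/eqP; apply: contraT => vc.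
by have := deg3 _ vc; rewrite inE d2 => /(_ isT).
Qed.

(** Unless they share two edges at some vertex, which then has degree 2 and is
    the root, a triangle abx and a quadrilateral on the edge ax contain a
    5-cycle. *)
Lemma tri_quad t q e : #|bd t| = 3 -> #|bd q| = 4 -> e \in bd t -> e \in bd q ->
  c \in e /\ deg S c = 2.
Proof.
move=> t3 q4 et eq; have tq : t != q by apply/eqP => E; rewrite E q4 in t3.
have [a [x [ax eE]]] := edge_ends sS (bdS et); rewrite eE in et eq *.
have [b [ba bx _ tE]] := triangle t3 et.
case: (@bd_small q a x) => [|//|[x' []]|[p [r [_ U qE]]]]; rewrite ?q4 //.
have [xp pr ra] : [/\ [set x; p] \in bd q, [set p; r] \in bd q & [set r; a] \in bd q].
  by rewrite qE !inE !eqxx ?orbT.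
have [xb ba'] : [set x; b] \in bd t /\ [set b; a] \in bd t.
  by rewrite tE !inE !eqxx ?orbT.
have cE v f : v \in [set a; x] -> v \in f -> [set a; x] != f -> f \in bd t ->
    f \in bd q -> c \in [set a; x] /\ deg S c = 2.
  move=> va vf ne ft fq; have d2 := share2 tq ne va vf et eq ft fq.
  by rewrite -(deg2_root va (bdS et) d2).
have [bp|bp] := eqVneq b p.
  apply: (cE x [set x; b]); rewrite ?set21 ?set22 ?bp -?bp //.
    by rewrite pair_eqE; neqs.
  by rewrite bp.
have [br|br] := eqVneq b r.
  apply: (cE a [set b; a]); rewrite ?set21 ?set22 //.
    by rewrite pair_eqE; neqs.
  by rewrite br.
case: (@noC5 a b x p r) => //; rewrite ?(bdS _) //.
- move: U; rewrite /= !inE !negb_or !andbT.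
  case/andP=> /and3P[_ ap ar] /andP[/andP[xp' xr] pr'].
  by rewrite eq_sym ba ax ap ar bx bp br xp' xr pr'.
- by rewrite setUC (bdS ba').
- by rewrite setUC (bdS xb).
- exact: bdS xp.
- exact: bdS pr.
- exact: bdS ra.
Qed.

Definition spine e :=
  [&& e \in S, s1 e != s2 e, #|bd (s1 e)| == 3 & #|bd (s2 e)| == 3].

Lemma spine_other e p : spine e -> e \in bd p ->
  exists q, [/\ q != p, e \in bd q, #|bd p| = 3 & #|bd q| = 3].
Proof.
case/and4P=> eS ne /eqP t1 /eqP t2; rewrite rimP // => /orP[] /eqP <-.
  by exists (s2 e); rewrite eq_sym rimP // eqxx orbT.
by exists (s1 e); rewrite rimP // eqxx.
Qed.

Lemma spineI e p q : e \in bd p -> e \in bd q -> p != q ->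
  #|bd p| = 3 -> #|bd q| = 3 -> spine e.
Proof.
move=> ep eq pq p3 q3; have [eS ne] := rimN ep; rewrite /spine eS ne /=.
move: ep eq; rewrite !rimP // => /orP[] /eqP E1 /orP[] /eqP E2.
- by rewrite -E1 E2 eqxx in pq.
- by rewrite E1 E2 p3 q3.
- by rewrite E1 E2 p3 q3.
- by rewrite -E1 E2 eqxx in pq.
Qed.

(** Let the common triangle be vax, and let vay and vxz be the triangles on the
    other sides of the two spines.  If y and z differ then v, y, a, x, z form a
    5-cycle; if they agree, the three triangles close up the link of v, which
    then has degree 3. *)
Lemma spines_share v a x p : 3 < deg S v -> a != x -> spine [set v; a] ->
  spine [set v; x] -> [set v; a] \in bd p -> [set v; x] \in bd p -> False.
Proof.
move=> dv ax sa sx ap xp.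
have [p1 [p1p ap1 p3 p13]] := spine_other sa ap.
have [p2 [p2p xp2 _ p23]] := spine_other sx xp.
have [b [bv ba va pE]] := triangle p3 ap.
have bx : b = x.
  have vx : v != x by apply/eqP => vx; have := sS (bdS xp2); rewrite vx setUid cards1.
  by move: xp; rewrite pE !inE !pair_eqE; neqs => /eqP.
subst b; have [y [yv ya _ p1E]] := triangle p13 ap1.
have [z [zv zx _ p2E]] := triangle p23 xp2.
have axp : [set a; x] \in bd p by rewrite pE !inE eqxx ?orbT.
have [ayp yvp] : [set a; y] \in bd p1 /\ [set y; v] \in bd p1.
  by rewrite p1E !inE !eqxx ?orbT.
have [xzp zvp] : [set x; z] \in bd p2 /\ [set z; v] \in bd p2.
  by rewrite p2E !inE !eqxx ?orbT.
have vax : [set v; a] != [set v; x].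
  by apply: contraNneq ax => /pair_inj ->.
have yx : y != x.
  apply/eqP => yx; have := @share2 p p1 v _ _ _ vax (set21 _ _) (set21 _ _) ap ap1 xp.
  by rewrite eq_sym [[set v; x]]setUC -yx => /(_ p1p yvp) d2; rewrite d2 in dv.
have za : z != a.
  apply/eqP => za; have := @share2 p p2 v _ _ _ vax (set21 _ _) (set21 _ _) ap _ xp xp2.
  by rewrite eq_sym [[set v; a]]setUC -za => /(_ p2p zvp) d2; rewrite d2 in dv.
(* Distinct apices give the 5-cycle v, y, a, x, z. *)
have [yz|yz] := eqVneq y z; last first.
  apply: (@noC5 v y a x z); rewrite ?(bdS axp) ?(bdS xzp) ?(bdS zvp) //.
  - by rewrite /= !inE; neqs.
  - by rewrite setUC (bdS yvp).
  - by rewrite setUC (bdS ayp).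
subst z; have p12 : p1 != p2.
  apply: contraTneq ap1 => ->; rewrite p2E !inE !pair_eqE; neqs.
have va' := vax; have vy1 : [set v; y] \in bd p1 by rewrite setUC.
have vy2 : [set v; y] \in bd p2 by rewrite setUC.
have n1 : [set v; a] \notin [set [set v; x]; [set v; y]].
  by rewrite !inE !pair_eqE; neqs.
have n2 : [set v; x] \notin [set [set v; y]].
  by rewrite !inE !pair_eqE; neqs.
suff E : [set v; a] |: [set [set v; x]; [set v; y]] = st v.
  by move: dv; rewrite /deg -E cardsU1 n1 cardsU1 n2 cards1.
apply: (link_connected sS cS dS).
- by apply/set0Pn; exists [set v; a]; rewrite setU11.
- by rewrite !subUset !sub1set !inE !eqxx (bdS ap) (bdS xp) (bdS vy1).
move=> w; rewrite (big_setU1 _ n1) /= (big_setU1 _ n2) /= big_set1.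
rewrite (rim_w w ap ap1) 1?eq_sym // (rim_w w xp xp2) 1?eq_sym //.
rewrite (rim_w w vy1 vy2) //.
by case: (w p); case: (w p1); case: (w p2).
Qed.

Definition fan v e := [set f in st v | (f \in bd (s1 e)) || (f \in bd (s2 e))].

Lemma in_fan v e f : (f \in fan v e) =
  [&& f \in S, v \in f & (f \in bd (s1 e)) || (f \in bd (s2 e))].
Proof. by rewrite in_set [f \in st v]in_set andbA. Qed.

Lemma tri_star p v a : #|bd p| = 3 -> [set v; a] \in bd p ->
  exists x, [/\ x != v, x != a, [set a; x] \in S &
    forall f, v \in f -> (f \in bd p) = (f == [set v; a]) || (f == [set v; x])].
Proof.
move=> p3 ap; have [x [xv xa va pE]] := triangle p3 ap; exists x; split=> //.
  by apply: (@bdS p); rewrite pE !inE eqxx orbT.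
move=> f vf; rewrite pE !inE [[set x; v]]setUC; case: (f =P [set a; x]) => [fE|].
  by move: vf; rewrite fE !inE; neqs.
by rewrite orbF.
Qed.

Lemma fanP v e : 3 < deg S v -> spine e -> v \in e ->
  exists a x y, [/\ e = [set v; a], [set a; x] \in S, x != v &
    a != v /\ fan v e = [set [set v; a]; [set v; x]; [set v; y]]] /\ #|fan v e| = 3.
Proof.
move=> dv se ve; have /and4P[eS ne /eqP t1 /eqP t2] := se.
have [a av eE] := edge_end sS eS ve; exists a.
have e1 : [set v; a] \in bd (s1 e) by rewrite -eE rimP // eqxx.
have e2 : [set v; a] \in bd (s2 e) by rewrite -eE rimP // eqxx orbT.
have [x [xv xa axS xP]] := tri_star t1 e1.
have [y [yv ya ayS yP]] := tri_star t2 e2.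
exists x, y; have xy : x != y.
  apply/eqP => xyE; have vax : [set v; a] != [set v; x] by apply: contraNneq xa => /pair_inj ->.
  have := share2 ne vax (set21 v a) (set21 v x) e1 e2.
  rewrite xP ?set21 // yP ?set21 // xyE eqxx orbT => /(_ isT isT) d2.
  by rewrite d2 in dv.
have fE : fan v e = [set [set v; a]; [set v; x]; [set v; y]].
  apply/setP => f; rewrite in_fan !in_setU !in_set1.
  have [vf|vf] := boolP (v \in f); last first.
    rewrite andbF /=; symmetry; apply: contraNF vf.
    by case/orP=> [/orP[]|] /eqP ->; rewrite set21.
  rewrite xP // yP //; have [fS|fS] := boolP (f \in S).
    by case: eqP => //=; case: eqP.
  symmetry; apply: contraNF fS; case/orP=> [/orP[]|] /eqP ->; first by rewrite -eE.
    by apply: (@bdS (s1 e)); rewrite xP ?set21 // eqxx orbT.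
  by apply: (@bdS (s2 e)); rewrite yP ?set21 // eqxx orbT.
split=> //; rewrite fE -setUA cardsU1 cards2 !inE !pair_eqE; neqs.
Qed.

(** An edge common to two fans is one of the two spines, or a third spine that
    shares a triangle with one of them, or lies in a triangle with three edges
    at v.  The last is absurd and [spines_share] excludes the others. *)
Lemma fan_disjoint v e e' f : 3 < deg S v -> spine e -> spine e' -> v \in e ->
  v \in e' -> f \in fan v e -> f \in fan v e' -> e = e'.
Proof.
move=> dv se se' ve ve' fe fe'; apply/eqP/negPn/negP => ee'.
have key g h p : spine g -> spine h -> v \in g -> v \in h -> g != h ->
    g \in bd p -> h \in bd p -> False.
  move=> sg sh vg vh gh gp hp; have [a av gE] := edge_end sS (bdS gp) vg.
  have [x xv hE] := edge_end sS (bdS hp) vh; subst g h.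
  by apply: (spines_share dv _ sg sh gp hp); apply: contraNneq gh => ->.
have side g h : spine g -> h \in fan v g -> exists p, [/\ g \in bd p, h \in bd p, v \in h & #|bd p| = 3].
  move=> /and4P[gS ng /eqP t1 /eqP t2]; rewrite in_fan => /and3P[_ vh /orP[]] H.
    by exists (s1 g); rewrite rimP // eqxx.
  by exists (s2 g); rewrite rimP // eqxx orbT.
have [p [ep fp vf p3]] := side e f se fe.
have [p' [ep' fp' _ p3']] := side e' f se' fe'.
have [fE|nfe] := eqVneq f e; first by apply: (key e e' p') => //; rewrite -fE.
have [fE|nfe'] := eqVneq f e'; first by apply: (key e e' p) => //; rewrite -fE.
have [pE|pp'] := eqVneq p p'; last first.
  by apply: (key e f p) => //; rewrite 1?eq_sym //; apply: spineI pp' _ _.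
subst p'; have [a av eE] := edge_end sS (bdS ep) ve; rewrite eE in ep ee' nfe.
have [x [_ _ _ xP]] := tri_star p3 ep.
move: fp ep'; rewrite !xP // (negbTE nfe) (eq_sym e') (negbTE ee') /=.
by move=> /eqP fE /eqP eE'; rewrite fE eE' eqxx in nfe'.
Qed.

Definition spines v := [set e in st v | spine e].
Definition cubic u := (u != c) && (deg S u == 3).
Definition cubic_nbr v f := [exists u in f, (u != v) && cubic u].

Lemma in_spines v e : (e \in spines v) = [&& e \in S, v \in e & spine e].
Proof. by rewrite in_set [e \in st v]in_set andbA. Qed.

(** Disjoint fans of three edges each. *)
Lemma spines_le3 v : 3 < deg S v -> 3 * #|spines v| <= deg S v.
Proof.
move=> dv; have fan3 e : e \in spines v -> #|fan v e| = 3.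
  by rewrite in_spines => /and3P[_ ve se]; have [a [x [y []]]] := fanP dv se ve.
rewrite mulnC -sum_nat_const -(eq_bigr _ fan3).
have -> : \sum_(e in spines v) #|fan v e| =
    \sum_(f in st v) #|[set e in spines v | f \in fan v e]|.
  under eq_bigr do rewrite -sum1_card.
  rewrite (exchange_big_dep (mem (st v))) /=; last first.
    by move=> e f _; rewrite in_fan => /and3P[fS vf _]; rewrite inE fS.
  by apply: eq_bigr => f _; rewrite -sum1_card; apply: eq_bigl => e; rewrite inE.
rewrite /deg -sum1_card leq_sum // => f _; rewrite leqNgt; apply/negP.
case/card_gt1P=> e [e' []]; rewrite in_set => /andP[es fe].
rewrite in_set => /andP[es' fe'] /eqP; apply.
move: es es'; rewrite !in_spines => /and3P[_ ve se] /and3P[_ ve' se'].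
exact: (fan_disjoint dv se se' ve ve' fe).
Qed.

(** The fans are disjoint, and each contains an edge whose far end is not
    cubic: the far ends of a spine and of a neighbouring edge of its fan are
    adjacent, and two adjacent vertices of degree 3 have too small a degree sum. *)
Lemma cubic_nbr_spines v : 3 < deg S v -> v != c ->
  #|spines v| + #|[set f in st v | cubic_nbr v f]| <= deg S v.
Proof.
move=> dv vc; set B := [set f in st v | _].
(* An edge of each fan whose far end is not cubic. *)
pose g e := odflt set0 [pick f in fan v e | ~~ cubic_nbr v f].
have gP e : e \in spines v -> g e \in fan v e /\ ~~ cubic_nbr v (g e).
  move=> es; rewrite /g; case: pickP => [f /andP[]//|N].
  move: es; rewrite in_spines => /and3P[_ ve se].
  have [a [x [y [[eE axS xv [av fE]] _]]]] := fanP dv se ve.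
  have small u : u != v -> [set v; u] \in fan v e -> cubic u.
    move=> uv uf; have := N [set v; u]; rewrite uf /= => /negbFE.
    by case/existsP=> u' /andP[]; rewrite !inE => /orP[] /eqP -> /andP[]; rewrite ?eqxx.
  have /andP[ac /eqP a3] : cubic a by apply: small; rewrite // fE !inE eqxx.
  have /andP[xc /eqP x3] : cubic x by apply: small; rewrite // fE !inE eqxx !orbT.
  by have := deg_sum ac xc axS; rewrite a3 x3; move: D7; clear; lia.
have injg : {in spines v &, injective g}.
  move=> e e' es es' E; have [g1 _] := gP e es; have [g2 _] := gP e' es'.
  move: es es'; rewrite !in_spines => /and3P[_ ve se] /and3P[_ ve' se'].
  by apply: (fan_disjoint dv se se' ve ve' g1); rewrite E.
rewrite -(card_in_imset injg) addnC.
have BS : B \subset st v by apply/subsetP => f; rewrite [f \in B]in_set => /andP[].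
have -> : deg S v = #|B| + #|st v :\: B|.
  by rewrite /deg -(cardsID B (st v)) (setIidPr BS).
rewrite leq_add2l; apply/subset_leq_card/subsetP => _ /imsetP[e es ->].
have [gf gs] := gP e es; move: gf; rewrite in_fan => /and3P[gS vg _].
rewrite in_setD [g e \in B]in_set (negbTE gs) andbF.
by rewrite [g e \in st v]in_set gS.
Qed.

Definition pays v := (v == c) || (4 < deg S v).

(** Charges are scaled by 3: a vertex starts with [3 * deg S v - 12], pays 2 for
    each incident spine and 1 for each cubic neighbour, and a cubic vertex
    receives 1 through each of its edges.  The root is granted 12.  For degree 7
    the estimate is sharp: two spines and five cubic neighbours cost 9. *)
Lemma vertex_charge v : v \in verts S ->
  12 + pays v * (2 * #|spines v| + #|[set f in st v | cubic_nbr v f]|) <=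
  3 * deg S v + cubic v * deg S v + 12 * (v == c).
Proof.
move=> vV; rewrite /pays /cubic.
have le1 : #|spines v| <= deg S v.
  by apply/subset_leq_card/subsetP => f; rewrite in_set => /andP[].
have le2 : #|[set f in st v | cubic_nbr v f]| <= deg S v.
  by apply/subset_leq_card/subsetP => f; rewrite in_set => /andP[].
set n := #|[set f in st v | cubic_nbr v f]|  in le2 *.
have nE : n = #|[set f in st v | cubic_nbr v f]| by [].
clearbody n.
set m := #|spines v|  in le1 *.
have mE : m = #|spines v| by [].
clearbody m.
have [vc|vc] /= := eqVneq v c; first by lia.
have d3 := deg3 vV vc; rewrite muln0 addn0.
have [d5|d5] /= := ltnP 4 (deg S v); last first.
  by case: eqP => [->|] /=; lia.
have -> : deg S v == 3 = false by apply/negbTE; lia.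
have d4 : 3 < deg S v by lia.
have := spines_le3 d4; have := cubic_nbr_spines d4 vc; rewrite -nE -mE.
have [d7|d7] := ltnP 6 (deg S v); first by lia.
(* A vertex of degree 5 or 6 has no cubic neighbour, as D + 3 >= 10. *)
suff n0 : n = 0 by rewrite n0; lia.
rewrite nE; apply/eqP; rewrite cards_eq0; apply/eqP.
apply/setP => f; rewrite in_set in_set0; apply/negbTE/negP => /andP[].
rewrite in_set => /andP[fS vf] /existsP[u /and3P[uf uv /andP[uc /eqP u3]]].
have [w wv fE] := edge_end sS fS vf; move: uf; rewrite fE !inE (negbTE uv) /=.
move=> /eqP uw; subst w; rewrite fE in fS.
by have := deg_sum vc uc fS; rewrite u3; move: D7 d7; clear; lia.
Qed.

(** A face of length l starts with [3 * l - 12].  Long faces give 1 through each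
    edge, triangles receive 1 through each edge. *)
Lemma face_charge p : p \in faces S s1 s2 ->
  12 + (6 <= #|bd p|) * #|bd p| <= 3 * #|bd p| + (#|bd p| == 3) * #|bd p|.
Proof. by case/face_size => H; [rewrite H|rewrite H|rewrite H]; lia. Qed.

Lemma sum_incidence (w : T -> {set T} -> nat) :
  \sum_(v in verts S) \sum_(e in st v) w v e = \sum_(e in S) \sum_(v in e) w v e.
Proof.
rewrite (exchange_big_dep (mem S)) /=; last by move=> v e _; rewrite inE => /andP[].
apply: eq_bigr => e eS; apply: eq_bigl => v; rewrite in_set [X in _ && X]in_set eS /=.
case: (boolP (v \in e)) => [ve|]; rewrite ?andbF // andbT.
by apply/card_gt0P; exists e; rewrite inE eS.
Qed.

Lemma sum_sides (w : F -> nat) :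
  \sum_(p in faces S s1 s2) w p * #|bd p| =
  \sum_(e in S) (if s1 e != s2 e then w (s1 e) + w (s2 e) else 0).
Proof.
have -> : \sum_(p in faces S s1 s2) w p * #|bd p| = \sum_p \sum_(e in bd p) w p.
  rewrite big_mkcond; apply: eq_bigr => p _; rewrite sum_nat_const mulnC inE.
  by case: eqP => // ->; rewrite cards0.
rewrite (exchange_big_dep (mem S)) /=; last by move=> p e _ /bdS.
apply: eq_bigr => e eS; case: ifP => [ne|/negbFE/eqP E].
  under eq_bigl do rewrite rimP //.
  rewrite (bigD1 (s1 e)) ?eqxx //= (bigD1 (s2 e)) ?eqxx ?orbT 1?eq_sym //=.
  rewrite big1 ?addn0 // => p /andP[/andP[]].
  by case/orP=> /eqP ->; rewrite eqxx.
by rewrite big_pred0 // => p; apply/negP => /rimN[_]; rewrite E eqxx.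
Qed.

(** An end of degree at most 4 that is not the root has the root or a vertex of
    degree at least 6 as its neighbour, and every neighbour of a cubic vertex
    other than the root has degree D. *)
Lemma edge_charge e : e \in S ->
  \sum_(v in e) cubic v + 2 * spine e <=
  \sum_(v in e) pays v * (2 * spine e + cubic_nbr v e).
Proof.
move=> eS; have [a [b [ab eE]]] := edge_ends sS eS.
have deg_ab : [|| a == c, b == c | D + 3 <= deg S a + deg S b].
  case: eqP => //= /eqP ac; case: eqP => //= /eqP bc.
  by apply: deg_sum; rewrite -?eE.
have nbrE v u : e = [set v; u] -> u != v -> cubic_nbr v e = cubic u.
  move=> -> uv; apply/existsP/idP => [[u' /and3P[]]|tu].
    by rewrite !inE => /orP[] /eqP -> //; rewrite eqxx.
  by exists u; rewrite set22 uv.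
have ba : b != a by rewrite eq_sym.
have eE' : e = [set b; a] by rewrite setUC.
have -> (w : T -> nat) : \sum_(v in e) w v = w a + w b.
  by rewrite eE big_setU1 ?inE //= big_set1.
have -> (w : T -> nat) : \sum_(v in e) w v = w a + w b.
  by rewrite eE big_setU1 ?inE //= big_set1.
rewrite (nbrE a b) // (nbrE b a) // /cubic /pays.
have := degD (v := a); have := degD (v := b).
move: deg_ab; case: (eqVneq a c) => [ac|ac] /=; case: (eqVneq b c) => [bc|bc] /=.
- by rewrite ac bc eqxx in ab.
- by move=> _ /(_ isT); case: (spine e); case: eqP => /=; case: ltnP => /=; lia.
- by move=> _ _ /(_ isT); case: (spine e); case: eqP => /=; case: ltnP => /=; lia.
move=> H /(_ isT) H1 /(_ isT) H2.
move: H H1 H2 D7; move: (deg S a) (deg S b) (spine e) => da db [] /=; clear;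
by case: eqP => /=; case: eqP => /=; case: ltnP => /=; case: ltnP => /=; lia.
Qed.

(** The at most two edges along which a triangle and a quadrilateral may meet. *)
Definition root_exc e := (c \in e) && (deg S c == 2).

(** What the triangles on the two sides of e receive is given by a long face on
    the other side, by the ends if e is a spine, or is an exception at the root. *)
Lemma side_charge e : e \in S ->
  (if s1 e != s2 e then (#|bd (s1 e)| == 3) + (#|bd (s2 e)| == 3) else 0) <=
  (if s1 e != s2 e then (6 <= #|bd (s1 e)|) + (6 <= #|bd (s2 e)|) else 0) +
  2 * spine e + root_exc e.
Proof.
move=> eS; rewrite /spine eS; case: ifP => //= ne.
have e1 : e \in bd (s1 e) by rewrite rimP // eqxx.
have e2 : e \in bd (s2 e) by rewrite rimP // eqxx orbT.
have f1 : s1 e \in faces S s1 s2 by rewrite in_set; apply/set0Pn; exists e.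
have f2 : s2 e \in faces S s1 s2 by rewrite in_set; apply/set0Pn; exists e.
case: (face_size f1) (face_size f2) => H1 [] H2; rewrite ?H1 ?H2 //=;
  try by (move: H1 H2; clear; lia).
- by have [ce d2] := tri_quad H1 H2 e1 e2; rewrite /root_exc ce d2.
- by have [ce d2] := tri_quad H2 H1 e2 e1; rewrite /root_exc ce d2.
Qed.

(** An edge with the same face on both sides would be closed in the link of
    each of its ends, and both would have degree 1; only the root can. *)
Lemma face_exists : S != set0 -> exists p, p \in faces S s1 s2.
Proof.
case/set0Pn=> e eS; have [a [b [ab eE]]] := edge_ends sS eS.
have [E|ne] := eqVneq (s1 e) (s2 e); last first.
  by exists (s1 e); rewrite in_set; apply/set0Pn; exists e; rewrite rimP // eqxx.
have ec v : v \in e -> v = c.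
  move=> ve; have d1 : deg S v = 1.
    rewrite /deg -(@link_connected _ _ _ _ _ sS cS dS v [set e]) ?cards1 //.
    - by apply/set0Pn; exists e; rewrite set11.
    - by rewrite sub1set inE eS.
    - by move=> w; rewrite big_set1 E addbb.
  apply/eqP; apply: contraT => vc.
  by have := deg3 _ vc; rewrite inE d1 => /(_ isT).
have ac : a = c by apply: ec; rewrite eE set21.
by move: ab; rewrite ac -(ec b) ?eqxx // eE set22.
Qed.

Lemma discharge : S != set0 -> False.
Proof.
move=> S0; have [p0 p0F] := face_exists S0; have /set0Pn[e0 e0S] := S0.
have [a [b [_ eE]]] := edge_ends sS e0S.
have aV : a \in verts S.
  by rewrite inE; apply/card_gt0P; exists e0; rewrite inE e0S eE set21.
have := euler_dual sS dS aV p0F.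
have dgE v : deg S v = \sum_(e in st v) 1 by rewrite sum1_card.
have sumV : \sum_(v in verts S) deg S v = 2 * #|S|.
  under eq_bigr do rewrite dgE.
  rewrite (sum_incidence (fun _ _ => 1)) mulnC -sum_nat_const.
  by apply: eq_bigr => e eS; rewrite sum1_card sS.
have sumF : \sum_(p in faces S s1 s2) #|bd p| <= 2 * #|S|.
  under eq_bigr do rewrite -[#|bd _|]mul1n.
  rewrite (sum_sides (fun _ => 1)) mulnC -sum_nat_const leq_sum // => e _.
  by case: ifP.
have V1 : 12 * #|verts S| +
    \sum_(v in verts S) pays v * (2 * #|spines v| + #|[set f in st v | cubic_nbr v f]|) <=
    3 * \sum_(v in verts S) deg S v + \sum_(v in verts S) cubic v * deg S v + 12.
  apply: (@leq_trans (\sum_(v in verts S) (3 * deg S v + cubic v * deg S v + 12 * (v == c)))).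
    rewrite mulnC -sum_nat_const -big_split /=; apply: leq_sum => v; exact: vertex_charge.
  rewrite big_split [X in X + _ <= _]big_split big_distrr /= leq_add2l.
  rewrite big_mkcond (bigD1 c) //= big1 ?addn0; first by case: ifP; rewrite ?eqxx.
  by move=> v /negbTE ->; case: ifP.
have V2 : \sum_(v in verts S) pays v * (2 * #|spines v| + #|[set f in st v | cubic_nbr v f]|) =
    \sum_(e in S) \sum_(v in e) pays v * (2 * spine e + cubic_nbr v e).
  have cnt v (P : pred {set T}) : #|[set f in st v | P f]| = \sum_(f in st v) P f.
    rewrite -sum1_card big_mkcond [RHS]big_mkcond /=.
    by apply: eq_bigr => f _; rewrite in_set; case: (f \in st v); case: (P f).
  rewrite -(sum_incidence (fun v e => pays v * (2 * spine e + cubic_nbr v e))).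
  apply: eq_bigr => v _; rewrite -[RHS]big_distrr /= big_split /=; congr (_ * (_ + _)).
    by rewrite cnt big_distrr.
  by rewrite cnt.
have V3 : \sum_(v in verts S) cubic v * deg S v = \sum_(e in S) \sum_(v in e) cubic v.
  rewrite -(sum_incidence (fun v _ => cubic v : nat)).
  by apply: eq_bigr => v _; rewrite sum_nat_const mulnC.
have V4 : \sum_(e in S) \sum_(v in e) cubic v + 2 * \sum_(e in S) spine e <=
    \sum_(e in S) \sum_(v in e) pays v * (2 * spine e + cubic_nbr v e).
  by rewrite big_distrr -big_split /=; apply: leq_sum => e; exact: edge_charge.
have F1 : 12 * #|faces S s1 s2| +
    \sum_(p in faces S s1 s2) (6 <= #|bd p|) * #|bd p| <=
    3 * \sum_(p in faces S s1 s2) #|bd p| +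
    \sum_(p in faces S s1 s2) (#|bd p| == 3) * #|bd p|.
  rewrite mulnC -sum_nat_const -big_split big_distrr -big_split /=.
  by apply: leq_sum => p; exact: face_charge.
have exc2 : \sum_(e in S) root_exc e <= 2.
  have [d2|/negbTE d2] := boolP (deg S c == 2); last first.
    by rewrite big1 // => e _; rewrite /root_exc d2 andbF.
  rewrite -(eqP d2) /deg -sum1_card big_mkcond [leqRHS]big_mkcond /=.
  by apply: leq_sum => e _; rewrite inE /root_exc; case: (e \in S) => //=; case: (c \in e) => //=; exact: leq_b1.
have F2 : \sum_(p in faces S s1 s2) (#|bd p| == 3) * #|bd p| <=
    \sum_(p in faces S s1 s2) (6 <= #|bd p|) * #|bd p| +
    2 * \sum_(e in S) spine e + \sum_(e in S) root_exc e.
  rewrite (sum_sides (fun p => #|bd p| == 3 : nat)).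
  rewrite (sum_sides (fun p => 6 <= #|bd p| : nat)).
  rewrite big_distrr -!big_split /=; apply: leq_sum => e; exact: side_charge.
move: sumV sumF V1 V2 V3 V4 F1 exc2 F2; clear.
move: (\sum_(v in verts S) deg S v) (\sum_(p in faces S s1 s2) #|bd p|).
move: (\sum_(v in verts S) pays v * _) (\sum_(v in verts S) cubic v * deg S v).
move: (\sum_(e in S) \sum_(v in e) cubic v) (\sum_(e in S) spine e).
move: (\sum_(e in S) \sum_(v in e) _) (\sum_(p in _) (6 <= #|bd p|) * #|bd p|).
move: (\sum_(p in _) (#|bd p| == 3) * #|bd p|) (\sum_(e in S) root_exc e).
move: #|S| #|verts S| #|faces S s1 s2|; lia.
Qed.

End Discharging.

Lemma rooted_deg (T : finType) (S S' : {set {set T}}) c v : S' \subset S ->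
  rooted S S' c -> v != c -> v \in verts S' -> deg S' v = deg S v.
Proof.
move=> sub /rootedP rS vc; rewrite inE => /card_gt0P[e']; rewrite inE.
case/andP=> e'S ve'; apply: eq_card => e; rewrite !inE.
case: (boolP (v \in e)) => [ve|]; rewrite ?andbF // !andbT.
by apply/idP/idP => [/(subsetP sub)//|eS]; apply: (rS v e e').
Qed.

(** The closure under subsets of the existence of duals is what allows passing
    to the core of [cohesive_core]. *)
Theorem light_edge (T : finType) (S : {set {set T}}) (D : nat) :
  simple S -> S != set0 -> 7 <= D -> (forall v, deg S v <= D) ->
  (forall S' : {set {set T}}, S' \subset S -> exists (F : finType) (s1 s2 : {set T} -> F), dual S' s1 s2) ->
  (forall a x p q r, uniq [:: a; x; p; q; r] -> [set a; x] \in S -> [set x; p] \in S ->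
    [set p; q] \in S -> [set q; r] \in S -> [set r; a] \in S -> False) ->
  exists u v, [set u; v] \in S /\ deg S u + deg S v <= D + 2.
Proof.
move=> sS S0 D7 dD duals noC5.
have [/existsP[u /existsP[v /andP[uvS d]]]|N] :=
    boolP [exists u, exists v, ([set u; v] \in S) && (deg S u + deg S v <= D + 2)].
  by exists u, v.
have big u v : [set u; v] \in S -> D + 3 <= deg S u + deg S v.
  move=> uvS; rewrite leqNgt addn3 ltnS; apply: contra N => H; apply/existsP; exists u.
  by apply/existsP; exists v; rewrite uvS addn2.
have [S' [c [sub S'0 rS cS]]] := cohesive_core sS S0.
have sS' : simple S' by move=> e /(subsetP sub)/sS.
have [F [s1 [s2 dS]]] := duals S' sub.
have dgE := rooted_deg sub rS.
have vert u v : [set u; v] \in S' -> u \in verts S'.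
  by move=> uv; rewrite inE; apply/card_gt0P; exists [set u; v]; rewrite inE uv set21.
exfalso; apply: (discharge sS' cS dS (c := c) (D := D)) => //.
- move=> v vV vc; rewrite dgE //; move: vV; rewrite inE => /card_gt0P[e].
  rewrite inE => /andP[eS' ve]; have [u _ eE] := edge_end sS' eS' ve.
  have := big v u; rewrite -eE (subsetP sub _ eS') => /(_ isT); have := dD u.
  clear; lia.
- move=> u v uc vc uv; have vu : [set v; u] \in S' by rewrite setUC.
  by rewrite !dgE ?(vert _ _ uv) ?(vert _ _ vu) //; apply/big/(subsetP sub).
- move=> v vc; have [vV|] := boolP (v \in verts S'); first by rewrite dgE.
  by rewrite inE -leqNgt leqn0 => /eqP ->.
move=> a x p q r U ax xp pq qr ra.
exact: (noC5 _ _ _ _ _ U (subsetP sub _ ax) (subsetP sub _ xp) (subsetP sub _ pq)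
  (subsetP sub _ qr) (subsetP sub _ ra)).
Qed.

(** * Duals of minors of the square lattice *)

Notation pt := (nat * nat)%type.
(** A lattice edge is given by its lower or left end and a flag, which is true
    for vertical edges; squares are named by their lower left corner. *)
Notation lattice_edge := (pt * bool)%type.
Implicit Types (P q : pt) (d : lattice_edge).

Definition next_pt (up : bool) P : pt := if up then (P.1, P.2.+1) else (P.1.+1, P.2).
Definition end1 d : pt := d.1.
Definition end2 d : pt := next_pt d.2 d.1.
Definition sq1 d : pt := d.1.
(** On the axes the truncated predecessor makes [sq2] agree with [sq1]. *)
Definition sq2 d : pt := if d.2 then (d.1.1.-1, d.1.2) else (d.1.1, d.1.2.-1).

Definition lattice_adj : rel pt := fun q q' =>
  [|| q' == next_pt false q, q' == next_pt true q, q == next_pt false q' | q == next_pt true q'].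

Definition edge_between q q' : lattice_edge :=
  if q' == next_pt false q then (q, false) else if q' == next_pt true q then (q, true) else
  if q == next_pt false q' then (q', false) else (q', true).

Lemma edge_betweenP q q' : lattice_adj q q' ->
  (end1 (edge_between q q') = q /\ end2 (edge_between q q') = q') \/
  (end1 (edge_between q q') = q' /\ end2 (edge_between q q') = q).
Proof.
rewrite /lattice_adj /edge_between; case: eqP => [->|_] /=; first by left.
case: eqP => [->|_] /=; first by left.
case: eqP => [->|_] /=; first by right.
by move/eqP => ->; right.
Qed.

(** Traversal count modulo 2, so that a walk need not be simple. *)
Fixpoint walk q (s : seq pt) d : bool :=
  if s is q' :: s' then (d == edge_between q q') (+) walk q' s' d else false.

(** The boundary modulo 2 of a set of lattice edges, at a point P with positive
    coordinates. *)
Definition odd_pt (z : lattice_edge -> bool) P : bool :=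
  z (P, false) (+) z (P, true) (+) z ((P.1.-1, P.2), false) (+) z ((P.1, P.2.-1), true).

Lemma odd_pt_edge d P : 0 < P.1 -> 0 < P.2 ->
  odd_pt (fun d' => d' == d) P = (P == end1 d) (+) (P == end2 d).
Proof.
case: P d => [[|i] [|j]] [[k l] []] //= _ _; rewrite /odd_pt /end1 /end2 /next_pt /=;
by rewrite !xpair_eqE ?andbF ?andbT ?addbF /= ?eqSS.
Qed.

Lemma odd_ptD z1 z2 P : odd_pt (fun d => z1 d (+) z2 d) P = odd_pt z1 P (+) odd_pt z2 P.
Proof. by rewrite /odd_pt; do 4!case: (z1 _) => //=; do 4!case: (z2 _). Qed.

Lemma odd_pt_big (I : finType) (A : pred I) (z : I -> lattice_edge -> bool) P :
  odd_pt (fun d => \big[addb/false]_(i | A i) z i d) P = \big[addb/false]_(i | A i) odd_pt (z i) P.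
Proof. by rewrite /odd_pt !big_split. Qed.

Lemma odd_ptM (b : bool) z P : odd_pt (fun d => b && z d) P = b && odd_pt z P.
Proof. by rewrite /odd_pt; case: b. Qed.

Lemma odd_pt_walk q s P : 0 < P.1 -> 0 < P.2 -> path lattice_adj q s ->
  odd_pt (walk q s) P = (P == q) (+) (P == last q s).
Proof.
move=> P1 P2; elim: s q => [|q' s IH] q /=; first by rewrite addbb.
case/andP=> st /IH E; rewrite odd_ptD odd_pt_edge // E.
by case: (edge_betweenP st) => -[-> ->]; case: (P == q); case: (P == q'); case: (P == _).
Qed.

Section GridMinor.
Variables (T : finType) (S : {set {set T}}) (n : nat).
Variables (beta : pt -> option T) (b : T -> pt).
Variables (eu ev : {set T} -> T) (c1 c2 : {set T} -> seq pt).
Hypothesis beta_range : forall q v, beta q = Some v ->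
  (0 < q.1 <= n) && (0 < q.2 <= n).
Hypothesis edgeE : forall e, e \in S -> eu e != ev e /\ e = [set eu e; ev e].
Hypothesis path1 : forall e, e \in S -> path lattice_adj (b (eu e)) (c1 e).
Hypothesis path2 : forall e, e \in S -> path lattice_adj (b (ev e)) (c2 e).
Hypothesis beta1 : forall e q, e \in S -> q \in b (eu e) :: c1 e -> beta q = Some (eu e).
Hypothesis beta2 : forall e q, e \in S -> q \in b (ev e) :: c2 e -> beta q = Some (ev e).
Hypothesis gate_step : forall e, e \in S ->
  lattice_adj (last (b (eu e)) (c1 e)) (last (b (ev e)) (c2 e)).

Definition gate e := edge_between (last (b (eu e)) (c1 e)) (last (b (ev e)) (c2 e)).
Definition chain e d :=
  walk (b (eu e)) (c1 e) d (+) walk (b (ev e)) (c2 e) d (+) (d == gate e).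
(** The lattice edges that are contracted in the minor. *)
Definition inner d := (beta (end1 d) != None) && (beta (end1 d) == beta (end2 d)).
(** The lattice edges that are not deleted in the minor. *)
Definition allowed d := inner d || [exists e in S, d == gate e].

Lemma walk_inner q s v d : path lattice_adj q s -> (forall q', q' \in q :: s -> beta q' = Some v) ->
  walk q s d -> inner d.
Proof.
elim: s q => //= q' s IH q /andP[st p] H.
have [-> _|_ /=] := eqVneq d (edge_between q q'); last first.
  by apply: IH => // q'' q''s; apply: H; rewrite inE q''s orbT.
have Hq : beta q = Some v by apply: H; rewrite inE eqxx.
have Hq' : beta q' = Some v by apply: H; rewrite !inE eqxx orbT.
by rewrite /inner; case: (edge_betweenP st) => -[-> ->]; rewrite Hq Hq' eqxx.
Qed.

Lemma gate_lab e : e \in S ->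
  (beta (end1 (gate e)) = Some (eu e) /\ beta (end2 (gate e)) = Some (ev e)) \/
  (beta (end1 (gate e)) = Some (ev e) /\ beta (end2 (gate e)) = Some (eu e)).
Proof.
move=> eS; have B1 := beta1 eS (mem_last _ _); have B2 := beta2 eS (mem_last _ _).
by rewrite /gate; case: (edge_betweenP (gate_step eS)) => -[-> ->]; rewrite B1 B2; [left|right].
Qed.

Lemma gate_inj : {in S &, injective gate}.
Proof.
move=> e e' eS e'S E; have [_ eE] := edgeE eS; have [_ e'E] := edgeE e'S.
rewrite eE e'E; have := gate_lab e'S; rewrite -E.
by case: (gate_lab eS) => -[-> ->] [[[->] [->]]|[[->] [->]]] //; rewrite setUC.
Qed.

Lemma gate_not_inner e : e \in S -> ~~ inner (gate e).
Proof.
move=> eS; have [ne _] := edgeE eS; rewrite /inner.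
have neS : (Some (eu e) == Some (ev e)) = false by apply/negbTE.
by case: (gate_lab eS) => -[-> ->] //=; rewrite 1?eq_sym neS.
Qed.

Lemma chain_walks e d : e \in S -> ~~ inner d -> chain e d = (d == gate e).
Proof.
move=> eS nd; rewrite /chain.
have -> : walk (b (eu e)) (c1 e) d = false.
  by apply: contraNF nd; apply: walk_inner (path1 eS) _ => q; exact: beta1.
have -> // : walk (b (ev e)) (c2 e) d = false.
by apply: contraNF nd; apply: walk_inner (path2 eS) _ => q; exact: beta2.
Qed.

Lemma odd_pt_chain e P : 0 < P.1 -> 0 < P.2 -> e \in S ->
  odd_pt (chain e) P = (P == b (eu e)) (+) (P == b (ev e)).
Proof.
move=> P1 P2 eS; rewrite odd_ptD odd_ptD !odd_pt_walk ?path1 ?path2 // odd_pt_edge // /gate.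
case: (edge_betweenP (gate_step eS)) => -[-> ->];
by do 4!case: (P == _).
Qed.

Notation F := ('I_n.+1 * 'I_n.+1)%type.
Notation E := ('I_n.+1 * 'I_n.+1 * bool)%type.
Definition to_sq (P : pt) : F := (inord P.1, inord P.2).
Definition of_sq (s : F) : pt := (val s.1, val s.2).
Definition of_ed (d : E) : lattice_edge := (of_sq d.1, d.2).
Definition to_ed (d : lattice_edge) : E := (to_sq d.1, d.2).

Lemma to_sqK P : P.1 <= n -> P.2 <= n -> of_sq (to_sq P) = P.
Proof. by case: P => i j /= H1 H2; rewrite /of_sq /= !inordK. Qed.

Lemma of_sqK s : to_sq (of_sq s) = s.
Proof. by case: s => i j; rewrite /to_sq /= !inord_val. Qed.

(** Squares on both sides of a deleted edge lie in the same face. *)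
Definition opening : rel F := fun s s' => [exists d : E, ~~ allowed (of_ed d) &&
  (((s, s') == (to_sq (sq1 (of_ed d)), to_sq (sq2 (of_ed d)))) ||
   ((s', s) == (to_sq (sq1 (of_ed d)), to_sq (sq2 (of_ed d)))))].

Lemma opening_sym : connect_sym opening.
Proof.
apply: sym_connect_sym => s s'; apply/existsP/existsP => -[d /andP[nd H]]; exists d;
by rewrite nd orbC.
Qed.

(** Canonical representatives of the classes of squares serve as faces. *)
Definition region (P : pt) : F := root opening (to_sq P).

Lemma region_opening d : d.1.1 <= n -> d.1.2 <= n -> ~~ allowed d ->
  region (sq1 d) = region (sq2 d).
Proof.
move=> d1 d2 nd; apply/eqP; rewrite /region root_connect; last exact: opening_sym.
apply: connect1; apply/existsP; exists (to_ed d).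
have -> : of_ed (to_ed d) = d by case: d d1 d2 nd => P k *; rewrite /of_ed /= to_sqK.
by rewrite nd eqxx.
Qed.

Lemma region_w (w : F -> bool) : (forall s s', opening s s' -> w s = w s') ->
  forall P, w (region P) = w (to_sq P).
Proof.
move=> H P; have := connect_root opening (to_sq P); rewrite -/(region P).
by move/(closed_connect (a := w)) => E; apply/esym/E => s s' /H.
Qed.

Definition side1 e := region (sq1 (gate e)).
Definition side2 e := region (sq2 (gate e)).

Lemma end1_range d : beta (end1 d) != None -> [&& 0 < d.1.1, d.1.1 <= n, 0 < d.1.2 & d.1.2 <= n].
Proof.
case: d => P k; rewrite /end1 /=; case B : (beta P) => [v|] // _.
by have /andP[/andP[-> ->] /andP[-> ->]] := beta_range B.
Qed.

Lemma allowed_range d : allowed d -> [&& 0 < d.1.1, d.1.1 <= n, 0 < d.1.2 & d.1.2 <= n].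
Proof.
move=> H; apply: end1_range; case/orP: H => [/andP[]//|/exists_inP[e eS /eqP ->]].
by case: (gate_lab eS) => -[-> _].
Qed.

Lemma gate_range e : e \in S ->
  [&& 0 < (gate e).1.1, (gate e).1.1 <= n, 0 < (gate e).1.2 & (gate e).1.2 <= n].
Proof.
by move=> eS; apply: allowed_range; apply/orP; right; apply/exists_inP; exists e.
Qed.

(** Lift the even set to an even set of lattice edges along the walks.  There,
    colour a square by the parity of the edges below it in its column: the
    colour changes exactly across the edges of the lift, for horizontal edges by
    definition, for vertical ones by induction on the height, since the lift is
    even at each lattice point.  No deleted edge is in the lift, so the colouring
    is constant on regions. *)
Lemma even_to_regions (z : {set T} -> bool) : (forall v, odd_at S z v = false) ->
  exists w : F -> bool, {in S, forall e, z e = w (side1 e) (+) w (side2 e)}.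
Proof.
move=> bz; pose Z d := \big[addb/false]_(e in S) (z e && chain e d).
have Zallowed d : ~~ allowed d -> Z d = false.
  rewrite negb_or => /andP[ni ng]; rewrite /Z big1 // => e eS.
  rewrite chain_walks //; case: eqP => [dE|]; rewrite ?andbF //.
  by case/negP: ng; apply/exists_inP; exists e; rewrite ?dE.
have Zgate e : e \in S -> Z (gate e) = z e.
  move=> eS; rewrite /Z (eq_bigr (fun e' => (e' == e) && z e')); last first.
    move=> e' e'S; rewrite chain_walks ?gate_not_inner // andbC eq_sym.
    by rewrite (inj_in_eq gate_inj).
  by rewrite xor_delta eS.
have bZ P : 0 < P.1 -> 0 < P.2 -> odd_pt Z P = false.
  move=> P1 P2; rewrite odd_pt_big; under eq_bigr => e eS do rewrite odd_ptM odd_pt_chain //.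
  have -> : \big[addb/false]_(e in S) (z e && ((P == b (eu e)) (+) (P == b (ev e)))) =
      \big[addb/false]_(e in S) \big[addb/false]_(v in e) (z e && (P == b v)).
    apply: eq_bigr => e eS; have [ne eE] := edgeE eS.
    have -> : \big[addb/false]_(v in e) (z e && (P == b v)) =
        \big[addb/false]_(v in [set eu e; ev e]) (z e && (P == b v)) by rewrite -eE.
    by rewrite big_setU1 ?inE //= big_set1; case: (z e).
  rewrite (exchange_big_dep predT) //= big1 // => v _.
  case: (P == b v); last by rewrite big1 // => e; rewrite andbF.
  by transitivity (odd_at S z v) => //; apply: eq_bigr => e _; rewrite andbT.
pose w0 (P : pt) := \big[addb/false]_(j < P.2.+1) Z ((P.1, val j), false).
have Z0 i j k : (i == 0) || (j == 0) -> Z ((i, j), k) = false.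
  by move=> ij; apply: Zallowed; apply: contraTN ij => /allowed_range /and4P[/= i0 _ j0 _]; lia.
have w0H i j : w0 (i, j.+1) = w0 (i, j) (+) Z ((i, j.+1), false).
  by rewrite /w0 /= big_ord_recr.
have w00 i : w0 (i, 0) = false by rewrite /w0 big_ord_recr big_ord0 /= Z0 ?orbT.
have w0V i j : w0 (i.+1, j) = w0 (i, j) (+) Z ((i.+1, j), true).
  elim: j => [|j IH]; first by rewrite !w00 Z0 ?orbT.
  have := bZ (i.+1, j.+1) isT isT; rewrite /odd_pt /= !w0H IH.
  by case: (w0 _); case: (Z _); case: (Z _); case: (Z _); case: (Z _).
have Zw d : Z d = w0 (sq1 d) (+) w0 (sq2 d).
  case: d => [[i j] []]; rewrite /sq1 /sq2 /=.
    case: i => [|i]; first by rewrite Z0 // addbb.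
    by rewrite w0V /=; case: (w0 _); case: (Z _).
  case: j => [|j]; first by rewrite Z0 ?orbT // addbb.
  by rewrite w0H /=; case: (w0 _); case: (Z _).
pose w (s : F) := w0 (of_sq s).
have sq2n d : d.1.1 <= n -> d.1.2 <= n -> (sq2 d).1 <= n /\ (sq2 d).2 <= n.
  by case: d => [[i j] []] /= *; split; lia.
have wO s s' : opening s s' -> w s = w s'.
  suff key (d : E) : ~~ allowed (of_ed d) ->
      w (to_sq (sq1 (of_ed d))) = w (to_sq (sq2 (of_ed d))).
    case/existsP=> d /andP[nd]; rewrite !xpair_eqE.
    by case/orP=> /andP[/eqP -> /eqP ->]; rewrite (key d).
  move=> nd; have := Zw (of_ed d); rewrite Zallowed // /w.
  have [|| H1 H2] := sq2n (of_ed d); rewrite /= ?leq_ord //.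
  rewrite !to_sqK // /sq1 /= ?leq_ord //.
  by case: (w0 _); case: (w0 _).
exists w => e eS; rewrite -Zgate // Zw /side1 /side2 !region_w // /w.
have /and4P[_ H1 _ H2] := gate_range eS.
by have [H3 H4] := sq2n _ H1 H2; rewrite !to_sqK.
Qed.

(** The boundary of a set of squares is even at each lattice point.  Summing
    over the points labelled v, the inner edges cancel, the deleted ones are not
    in the boundary, and the gates of the edges at v remain. *)
Lemma regions_to_even (w : F -> bool) (z : {set T} -> bool) :
  {in S, forall e, z e = w (side1 e) (+) w (side2 e)} -> forall v, odd_at S z v = false.
Proof.
move=> zE v; pose W P := w (region P); pose Z d := W (sq1 d) (+) W (sq2 d).
have bZ P : 0 < P.1 -> 0 < P.2 -> odd_pt Z P = false.
  case: P => [[|i] [|j]] //= _ _; rewrite /odd_pt /Z /sq1 /sq2 /=.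
  by case: (W (i.+1, j.+1)); case: (W (i.+1, j)); case: (W (i, j.+1)); case: (W (i, j)).
have Zna d : d.1.1 <= n -> d.1.2 <= n -> ~~ allowed d -> Z d = false.
  by move=> H1 H2 nd; rewrite /Z /W region_opening // addbb.
have Zgate e : e \in S -> Z (gate e) = z e by move=> eS; rewrite zE.
have ofK d : d.1.1 <= n -> d.1.2 <= n -> of_ed (to_ed d) = d.
  by case: d => Q k H1 H2; rewrite /of_ed /= to_sqK.
have toK (d' : E) : to_ed (of_ed d') = d' by case: d' => s k; rewrite /to_ed /= of_sqK.
have at_P P : 0 < P.1 <= n -> 0 < P.2 <= n ->
    \big[addb/false]_(d : E) (Z (of_ed d) && ((P == end1 (of_ed d)) (+) (P == end2 (of_ed d)))) = false.
  move=> /andP[P1 P1n] /andP[P2 P2n]; rewrite -[RHS](bZ P) //.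
  under eq_bigr => d _ do rewrite -odd_pt_edge // -odd_ptM.
  rewrite -(odd_pt_big predT).
  have Zin d : d.1.1 <= n -> d.1.2 <= n ->
      \big[addb/false]_(d' : E) (Z (of_ed d') && (d == of_ed d')) = Z d.
    move=> H1 H2; rewrite (eq_bigr (fun d' : E => (d' == to_ed d) && Z (of_ed d'))).
      by rewrite xor_delta /= ofK.
    move=> d' _; rewrite andbC; congr (_ && _).
    by apply/eqP/eqP => [->|->]; rewrite ?toK ?ofK.
  by rewrite /odd_pt !Zin //=; clear -P1 P1n P2 P2n; lia.
pose at_v q := beta q == Some v.
have total : \big[addb/false]_(d : E) (Z (of_ed d) && (at_v (end1 (of_ed d)) (+) at_v (end2 (of_ed d)))) = false.
  transitivity (\big[addb/false]_(s : F | at_v (of_sq s)) \big[addb/false]_(d : E)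
      (Z (of_ed d) && ((of_sq s == end1 (of_ed d)) (+) (of_sq s == end2 (of_ed d))))).
    rewrite exchange_big /=; apply: eq_bigr => d _.
    (* Each labelled point occurs exactly once among the indices s. *)
    have pick_at q : \big[addb/false]_(s : F | at_v (of_sq s)) (of_sq s == q) = at_v q.
      have [qv|qv] := boolP (at_v q).
        have /andP[/andP[_ q1] /andP[_ q2]] := beta_range (eqP qv).
        rewrite (eq_bigr (fun s => (s == to_sq q) && true)) => [|s _].
          by rewrite xor_delta to_sqK // qv.
        rewrite andbT; apply/eqP/eqP => [<-|->]; by rewrite ?of_sqK ?to_sqK.
      by rewrite big1 // => s sv; apply: contraNF qv => /eqP <-.
    case: (Z _) => /=; last by rewrite big1.
    by rewrite big_split /= !pick_at.
  rewrite big1 // => s sv; have /andP[H1 H2] := beta_range (eqP sv); exact: at_P.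
rewrite -[RHS]total /odd_at.
transitivity (\big[addb/false]_(d : E) \big[addb/false]_(e in S)
    ((d == to_ed (gate e)) && (z e && (v \in e)))).
  rewrite (exchange_big_dep (mem S)) //= big_mkcond [RHS]big_mkcond /=.
  rewrite big_mkcond [RHS]big_mkcond /=; apply: eq_bigr => e _.
  case: (boolP (e \in S)) => //= eS.
  by rewrite (xor_delta predT (fun=> z e && (v \in e))) /= ; case: (v \in e); rewrite ?andbT ?andbF.
apply: eq_bigr => d _.
have dn : (of_ed d).1.1 <= n /\ (of_ed d).1.2 <= n by rewrite /= !leq_ord.
have gv e : e \in S -> at_v (end1 (gate e)) (+) at_v (end2 (gate e)) = (v \in e).
  move=> eS; have [ne eE] := edgeE eS; rewrite {3}eE in_pair // ![v == _]eq_sym /at_v.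
  have SE (x y : T) : (Some x == Some y) = (x == y) by [].
  by case: (gate_lab eS) => -[-> ->]; rewrite !SE // addbC.
have gK e : e \in S -> of_ed (to_ed (gate e)) = gate e.
  move=> eS; have /and4P[_ g1 _ g2] := gate_range eS; exact: ofK.
have [al|na] := boolP (allowed (of_ed d)); last first.
  rewrite Zna //; [|by case: dn|by case: dn].
  rewrite big1 // => e eS; case: eqP => // dE; case/negP: na.
  by apply/orP; right; apply/exists_inP; exists e; rewrite // dE gK.
have [inn|ninn] := boolP (inner (of_ed d)).
  have -> : at_v (end1 (of_ed d)) (+) at_v (end2 (of_ed d)) = false.
    by case/andP: inn => _ /eqP E1; rewrite /at_v E1 addbb.
  rewrite andbF big1 // => e eS; case: eqP => // dE.
  by have := gate_not_inner eS; rewrite -gK // -dE inn.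
have /exists_inP[e0 e0S /eqP dE] : [exists e in S, of_ed d == gate e].
  by move: al; rewrite /allowed (negbTE ninn).
rewrite (eq_bigr (fun e => (e == e0) && (z e && (v \in e)))).
  by rewrite xor_delta e0S dE Zgate // gv.
move=> e eS; congr (_ && _); apply/eqP/eqP => [dE'|->]; last by rewrite -dE toK.
by apply: gate_inj => //; rewrite -dE dE' gK.
Qed.

Lemma grid_dual : dual S side1 side2.
Proof. by move=> z; split=> [/even_to_regions|[w]]//; exact: regions_to_even. Qed.

End GridMinor.

(** * Lattice paths that follow families of paths *)

Lemma path_prefix (T : eqType) (r : rel T) x p a : path r x p -> a \in x :: p ->
  exists p', [/\ path r x p', last x p' = a & {subset p' <= p}].
Proof.
move=> xp ap; move: xp; case/splitPl: ap => p1 p2 E; rewrite cat_path => /andP[p1P _].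
by exists p1; split=> // y yp1; rewrite mem_cat yp1.
Qed.

(** Take the last visit to A before the first subsequent visit to B. *)
Lemma path_crossing (T : eqType) (r : rel T) (A B : pred T) x p :
  path r x p -> A x -> B (last x p) -> (forall y, A y -> ~~ B y) ->
  exists a N y, [/\ a \in x :: p, A a, B y, y \in p &
    [/\ path r a (rcons N y), {subset N <= p} & all (fun z => ~~ A z && ~~ B z) N]].
Proof.
move=> xp Ax Bl AB.
suff: (exists N y, [/\ B y, y \in p, path r x (rcons N y), {subset N <= p} &
        all (fun z => ~~ A z && ~~ B z) N]) \/
      (exists a N y, [/\ a \in p, A a, B y, y \in p &
        [/\ path r a (rcons N y), {subset N <= p} & all (fun z => ~~ A z && ~~ B z) N]]).
  case=> [[N [y [By yp xN Np aN]]]|[a [N [y [ap Aa By yp [aN Np AN]]]]]].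
    by exists x, N, y; rewrite mem_head.
  by exists a, N, y; rewrite inE ap orbT.
have nBx : ~~ B x by apply: AB.
elim: p x xp {Ax} nBx Bl => [|y p IH] x /=; first by move=> _ /negbTE ->.
case/andP=> xy yp nBx Bl; have [By|nBy] := boolP (B y).
  by left; exists [::], y; rewrite /= xy mem_head.
have sub (N : seq T) : {subset N <= p} -> {subset N <= y :: p}.
  by move=> H z /H; rewrite inE orbC => ->.
case: (IH y yp nBy Bl) => [[N [z [Bz zp yN Np aN]]]|[a [N [z [ap Aa Bz zp [aN Np AN]]]]]].
  have [Ay|nAy] := boolP (A y).
    by right; exists y, N, z; rewrite mem_head inE zp orbT; split=> //; split=> //; exact: sub.
  left; exists (y :: N), z; rewrite inE zp orbT /= xy yN nAy nBy aN; split=> //.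
  by move=> t; rewrite inE => /orP[/eqP ->|/Np tp]; rewrite inE ?eqxx ?tp ?orbT.
by right; exists a, N, z; rewrite !inE ap zp !orbT; split=> //; split=> //; exact: sub.
Qed.

Section ArcsToGrid.
Variables (T : finType) (S : {set {set T}}) (n : nat) (b : T -> pt).
Variables (eu ev : {set T} -> T) (P1 P2 P0 : {set T} -> seq pt).
Let W1 e := b (eu e) :: P1 e.
Let W2 e := b (ev e) :: P2 e.
Let W0 e := last (b (eu e)) (P1 e) :: P0 e.
Hypothesis edgeE : forall e, e \in S -> eu e != ev e /\ e = [set eu e; ev e].
Hypothesis path1 : forall e, e \in S -> path lattice_adj (b (eu e)) (P1 e).
Hypothesis path2 : forall e, e \in S -> path lattice_adj (b (ev e)) (P2 e).
Hypothesis path0 : forall e, e \in S -> path lattice_adj (last (b (eu e)) (P1 e)) (P0 e).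
Hypothesis path0_end : forall e, e \in S ->
  last (last (b (eu e)) (P1 e)) (P0 e) = last (b (ev e)) (P2 e).
Hypothesis range : forall e q, e \in S -> q \in W1 e ++ W2 e ++ W0 e ->
  (0 < q.1 <= n) && (0 < q.2 <= n).
Hypothesis meet11 : forall e e' q, e \in S -> e' \in S -> q \in W1 e -> q \in W1 e' ->
  eu e = eu e'.
Hypothesis meet12 : forall e e' q, e \in S -> e' \in S -> q \in W1 e -> q \in W2 e' ->
  eu e = ev e'.
Hypothesis meet22 : forall e e' q, e \in S -> e' \in S -> q \in W2 e -> q \in W2 e' ->
  ev e = ev e'.
Hypothesis meet01 : forall e e' q, e \in S -> e' \in S -> q \in W0 e -> q \in W1 e' -> e = e'.
Hypothesis meet02 : forall e e' q, e \in S -> e' \in S -> q \in W0 e -> q \in W2 e' -> e = e'.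
Hypothesis meet00 : forall e e' q, e \in S -> e' \in S -> q \in W0 e -> q \in W0 e' -> e = e'.

(** The branch set of v is made of the near parts at v, together with the
    middle parts, cut down to where they are outside the near parts, of the
    edges that have v as first end.  All near parts at v start from [b v], so a
    middle part that leaves a near part at any of its points can be reached from
    [b v] within the branch set. *)
Lemma arcs_dual : exists (F : finType) (s1 s2 : {set T} -> F), dual S s1 s2.
Proof.
have split_arc e : exists t : seq pt * seq pt * seq pt, e \in S ->
    let: (N, c1, c2) := t in
    [/\ path lattice_adj (b (eu e)) (c1 ++ N), path lattice_adj (b (ev e)) c2,
        lattice_adj (last (b (eu e)) (c1 ++ N)) (last (b (ev e)) c2) &
    [/\ {subset b (eu e) :: c1 <= W1 e}, {subset b (ev e) :: c2 <= W2 e},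
        {subset N <= W0 e} & all (fun z => (z \notin W1 e) && (z \notin W2 e)) N]].
  have [eS|] := boolP (e \in S); last by exists ([::], [::], [::]).
  have [ne _] := edgeE eS.
  (* Between a, the last point of the middle part near the first end, and y, the
     next one near the second end, the middle part avoids both. *)
  have [||z z1|a [N [y [a0 a1 y2 y0 [aN N0 Navoid]]]]] :=
      @path_crossing _ _ (fun q => q \in W1 e) (fun q => q \in W2 e) _ _ (path0 eS).
  - exact: mem_last.
  - by rewrite path0_end //; exact: mem_last.
  - by apply: contraNN ne => z2; rewrite (meet12 eS eS z1 z2).
  have [c1 [c1P c1a c1S]] := path_prefix (path1 eS) a1.
  have [c2 [c2P c2y c2S]] := path_prefix (path2 eS) y2.
  exists (N, c1, c2) => _; rewrite cat_path c1P c1a c2y last_cat c1a.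
  move: aN; rewrite rcons_path => /andP[-> ->]; split=> //.
  have cons_sub (x : pt) s s' : {subset s <= s'} -> {subset x :: s <= x :: s'}.
    by move=> H z; rewrite !inE => /orP[->//|/H ->]; rewrite orbT.
  split=> //; [exact: cons_sub|exact: cons_sub|].
  by move=> z /N0 zP; rewrite inE zP orbT.
have [f fP] := fin_all_exists split_arc.
pose N e := (f e).1.1; pose c1 e := (f e).1.2; pose c2 e := (f e).2.
have {}fP e : e \in S -> [/\ path lattice_adj (b (eu e)) (c1 e ++ N e), path lattice_adj (b (ev e)) (c2 e),
        lattice_adj (last (b (eu e)) (c1 e ++ N e)) (last (b (ev e)) (c2 e)) &
    [/\ {subset b (eu e) :: c1 e <= W1 e}, {subset b (ev e) :: c2 e <= W2 e},
        {subset N e <= W0 e} & all (fun z => (z \notin W1 e) && (z \notin W2 e)) (N e)]].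
  by move=> eS; have := fP e eS; rewrite /N /c1 /c2; case: (f e) => [[N' c1'] c2'].
(* A point of N takes the label of the first end of its arc. *)
pose beta q := if [pick e in S | (q \in W1 e) || (q \in N e)] is Some e then Some (eu e)
  else if [pick e in S | q \in W2 e] is Some e then Some (ev e) else None.
have N0 e q : e \in S -> q \in N e -> [/\ q \in W0 e, q \notin W1 e & q \notin W2 e].
  move=> eS qN; have [_ _ _ [_ _ H /allP/(_ q qN)/andP[]]] := fP e eS.
  by split=> //; exact: H.
have beta_near e q : e \in S -> (q \in W1 e) || (q \in N e) -> beta q = Some (eu e).
  move=> eS qe; rewrite /beta; case: pickP => [e' /andP[e'S qe']|/(_ e)]; last first.
    by rewrite eS qe.
  congr Some; case/orP: qe => [q1|/N0[]// q0 q1N _]; case/orP: qe' => [q1'|/N0[]// q0' q1N' _].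
  - exact: meet11 q1' q1.
  - by rewrite (meet01 e'S eS q0' q1).
  - by rewrite (meet01 eS e'S q0 q1').
  - by rewrite (meet00 eS e'S q0 q0').
have beta_far e q : e \in S -> q \in W2 e -> beta q = Some (ev e).
  move=> eS q2; rewrite /beta; case: pickP => [e' /andP[e'S /orP[q1|/N0[]// q0 _ q2N]]|_].
  - by rewrite (meet12 e'S eS q1 q2).
  - by move: q2N; rewrite (meet02 e'S eS q0 q2) q2.
  case: pickP => [e' /andP[e'S q2']|/(_ e)]; last by rewrite eS q2.
  by rewrite (meet22 e'S eS q2' q2).
have beta_range q v : beta q = Some v -> (0 < q.1 <= n) && (0 < q.2 <= n).
  rewrite /beta; case: pickP => [e /andP[eS /orP[q1|/N0[]// q0 _ _]] _|_].
  - by apply: (range eS); rewrite mem_cat q1.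
  - by apply: (range eS); rewrite !mem_cat q0 !orbT.
  case: pickP => // e /andP[eS q2] _; apply: (range eS).
  by rewrite !mem_cat q2 !orbT.
do 3!eexists; apply: (@grid_dual T S n beta b eu ev (fun e => c1 e ++ N e) c2) => //.
- by move=> e /fP[].
- by move=> e /fP[].
- move=> e q eS; have [_ _ _ [H1 _ _ _]] := fP e eS.
  rewrite -cat_cons mem_cat => /orP[/H1 q1|qN]; apply: beta_near => //.
    by rewrite q1.
  by rewrite qN orbT.
- by move=> e q eS; have [_ _ _ [_ H2 _ _]] := fP e eS; move/H2; exact: beta_far.
- by move=> e /fP[].
Qed.

End ArcsToGrid.

(** * Approximating arcs by lattice paths *)

Section Arcs.
Import all_order all_algebra lra.
Import boolp classical_sets prodnormedzmodule topology normedtype.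
Import Order.TTheory GRing.Theory Num.Theory numFieldNormedType.Exports.
Local Open Scope classical_set_scope.
Local Open Scope ring_scope.
Variable R : realType.
Implicit Types (f g : R -> R * R).

Notation arc f := {within `[0%R, 1%R], continuous f}.

(** The distances between points of the two arcs form a compact set of reals;
    if it omits 0 then so does a neighbourhood of 0. *)
Lemma arcs_separated f g : arc f -> arc g ->
  (exists s t : R, [/\ s \in `[0, 1], t \in `[0, 1] & f s = g t]) \/
  (exists2 d : R, 0 < d & forall s t, s \in `[0, 1] -> t \in `[0, 1] -> d <= `|f s - g t|).
Proof.
move=> cf cg; have [//|N] := pselect (exists s t : R, [/\ s \in `[0, 1], t \in `[0, 1] & f s = g t]).
  by left.
right; have Kf := continuous_compact cf (@segment_compact R 0 1).
have Kg := continuous_compact cg (@segment_compact R 0 1).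
have K := compact_setX Kf Kg.
pose h (x : (R * R) * (R * R)) : R := `|x.1 - x.2|.
have ch : continuous h.
  move=> x; apply: (@continuous_comp _ _ _ (fun x : (R * R) * (R * R) => x.1 - x.2) Num.norm).
    exact: sub_continuous.
  exact: norm_continuous.
have Kh : compact (h @` ((f @` `[0, 1]) `*` (g @` `[0, 1]))).
  by apply: continuous_compact K; apply: continuous_subspaceT.
have : open (~` (h @` ((f @` `[0, 1]) `*` (g @` `[0, 1])))).
  by apply: closed_openC; apply: compact_closed Kh; exact: Rhausdorff.
rewrite openE => /(_ 0) []; last first.
  move=> d /= d0 H; exists d => // s t sI tI; rewrite leNgt; apply/negP => lt.
  have /= := H `|f s - g t|; rewrite sub0r normrN normr_id => /(_ lt); apply.
  by exists (f s, g t) => //; split; [exists s|exists t].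
move=> [[x y] /= [[s sI sE] [t tI tE]]]; rewrite /h /= -sE -tE => /eqP; rewrite normr_eq0 subr_eq0.
by move/eqP => E; apply: N; exists s, t.
Qed.

Lemma arc_near f s (e : R) : arc f -> s \in `[0, 1] -> 0 < e ->
  exists2 d : R, 0 < d & forall t, t \in `[0, 1] -> `|t - s| < d -> `|f s - f t| < e.
Proof.
move=> /subspace_continuousP cf sI e0; have /cvgrPdist_lt/(_ _ e0) := cf s sI.
case=> d /= d0 H; exists d => // t tI ts; apply: H => //=.
by rewrite distrC.
Qed.

(** The supremum of the times that can be reached by steps of size less than e
    is reached, and is 1. *)
Lemma arc_chain f (e : R) : arc f -> 0 < e ->
  exists ts : seq R, [/\ path (fun s t => `|f s - f t| < e) 0 ts, last 0 ts = 1 &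
    {in 0 :: ts, forall t, t \in `[0, 1]}].
Proof.
move=> cf e0.
pose C t := exists ts : seq R, [/\ path (fun s t => `|f s - f t| < e) 0 ts,
  last 0 ts = t & {in 0 :: ts, forall t, t \in `[0, 1]}].
have step s t : C s -> t \in `[0, 1] -> `|f s - f t| < e -> C t.
  move=> [ts [pts lts Its]] tI st; exists (rcons ts t); rewrite rcons_path pts lts st last_rcons.
  by split=> // x; rewrite -rcons_cons mem_rcons inE => /orP[/eqP -> //|/Its].
have C0 : C 0.
  by exists [::]; split=> // x; rewrite inE => /eqP ->; rewrite in_itv /= lexx ler01.
have CI t : C t -> t \in `[0, 1].
  by move=> [ts [_ <- H]]; apply: H; exact: mem_last.
have hs : has_sup [set t | C t].
  split; first by exists 0.
  by exists 1 => t /CI; rewrite in_itv /= => /andP[].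
pose s := sup [set t | C t].
have ub t : C t -> t <= s by move=> Ct; apply: ub_le_sup => //; case: hs.
have sI : s \in `[0, 1].
  rewrite in_itv /= ub //=; apply: ge_sup; first by case: hs.
  by move=> t /CI; rewrite in_itv /= => /andP[].
have [d d0 near] := arc_near cf sI e0.
have [t Ct ts] := sup_adherent d0 hs.
have Cs : C s.
  apply: (step t) => //; rewrite distrC; apply: near; first exact: CI.
  by rewrite distrC ger0_norm ?subr_ge0 ?ub // ltrBlDl -ltrBlDr.
have [s1|s1] := ltP s 1; last first.
  have sE : s = 1 by apply/eqP; rewrite eq_le s1 andbT; move: sI; rewrite in_itv => /andP[].
  by move: Cs; rewrite sE.
have s0 : 0 <= s by apply: ub.
(* A reachable time beyond s. *)
pose t' := Num.min 1 (s + d / 2).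
have st' : s < t' by rewrite lt_min s1 /=; lra.
suff /ub : C t' by rewrite leNgt st'.
apply: (step s) => //.
  by rewrite in_itv /= ge_min lexx /= andbT; apply: ltW; apply: le_lt_trans st'.
apply: near; first by rewrite in_itv /= ge_min lexx /= andbT; apply: ltW; apply: le_lt_trans st'.
rewrite ger0_norm ?subr_ge0 ?ltW //; rewrite /t' ltrBlDl gt_min; apply/orP; right; lra.
Qed.

Lemma unit_path1 (x y i j : nat) : (x <= y.+1)%N -> (y <= x.+1)%N ->
  exists s, [/\ path lattice_adj (x, i) s, last (x, i) s = (y, i) & {subset s <= [:: (y, i)]}] .
Proof.
move=> H1 H2; have [->|ne] := eqVneq x y; first by exists [::].
exists [:: (y, i)]; split=> //=; rewrite andbT /lattice_adj /next_pt /= !xpair_eqE !eqxx !andbT.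
have : (y == x.+1)%N || (x == y.+1)%N by lia.
by case/orP=> ->; rewrite ?orbT.
Qed.

Lemma lattice_adj_swap (q q' : pt) : lattice_adj (q.2, q.1) (q'.2, q'.1) = lattice_adj q q'.
Proof.
case: q q' => [a b] [c d]; rewrite /lattice_adj /next_pt /= !xpair_eqE.
by do 8!case: (_ == _).
Qed.

Lemma unit_path2 (x y i : nat) : (x <= y.+1)%N -> (y <= x.+1)%N ->
  exists s, [/\ path lattice_adj (i, x) s, last (i, x) s = (i, y) & {subset s <= [:: (i, y)]}].
Proof.
move=> H1 H2; have [->|ne] := eqVneq x y; first by exists [::].
exists [:: (i, y)]; split=> //=; rewrite andbT -lattice_adj_swap /lattice_adj /next_pt /= !xpair_eqE !eqxx !andbT.
have : (y == x.+1)%N || (x == y.+1)%N by lia.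
by case/orP=> ->; rewrite ?orbT.
Qed.

(** Lattice points whose coordinates differ by at most 1 are joined within
    their common unit square, along at most two edges. *)
Lemma stair (q q' : pt) : (q.1 <= q'.1.+1)%N -> (q'.1 <= q.1.+1)%N ->
  (q.2 <= q'.2.+1)%N -> (q'.2 <= q.2.+1)%N ->
  exists s, [/\ path lattice_adj q s, last q s = q' &
    {in s, forall r, (r.1 \in [:: q.1; q'.1]) && (r.2 \in [:: q.2; q'.2])}].
Proof.
case: q q' => [a b] [c d] /= H1 H2 H3 H4.
have [s1 [p1 l1 S1]] := @unit_path1 a c b b H1 H2.
have [s2 [p2 l2 S2]] := @unit_path2 b d c H3 H4.
exists (s1 ++ s2); rewrite cat_path p1 l1 p2 last_cat l1 l2; split=> // r.
rewrite mem_cat => /orP[/S1|/S2]; rewrite inE => /eqP -> /=;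
by rewrite !inE !eqxx !orbT.
Qed.

Section Lattice.
Variables (h C : R).
Hypothesis h0 : 0 < h.

(** The shift C makes all the coordinates that occur positive. *)
Definition snap1 (x : R) : nat := Num.truncn ((x + C) / h).
Definition snap (u : R * R) : pt := (snap1 u.1, snap1 u.2).

Lemma snap1_close x y : `|x - y| < h -> (snap1 y <= (snap1 x).+1)%N.
Proof.
move=> xy; rewrite /snap1 truncn_le_nat ltr_pdivrMr //.
have := truncnS_gt ((x + C) / h); rewrite ltr_pdivrMr // => H.
move: xy; rewrite ltr_norml => /andP[H1 H2].
rewrite -[(_.+2)%:R]natr1 mulrDl mul1r; lra.
Qed.

Lemma snap1_near x y k : `|x - y| < h -> 0 <= x + C -> 0 <= y + C ->
  k \in [:: snap1 x; snap1 y] -> `|h * k%:R - (x + C)| <= 2 * h.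
Proof.
have key z : 0 <= z + C -> h * (snap1 z)%:R <= z + C < h * (snap1 z)%:R + h.
  move=> z0; have /truncn_itv/andP[] : 0 <= (z + C) / h by rewrite divr_ge0 // ltW.
  rewrite -/(snap1 z) ler_pdivlMr // ltr_pdivrMr // -natr1 mulrDl mul1r.
  by rewrite ![_ * h]mulrC => -> ->.
move=> xy /key/andP[x1 x2] /key/andP[y1 y2]; move: xy; rewrite ltr_norml => /andP[H1 H2].
by rewrite !inE ler_norml => /orP[] /eqP ->; apply/andP; split; lra.
Qed.

Definition fits (u : R * R) := (h <= u.1 + C) && (h <= u.2 + C).
Definition near_pt (r : pt) (u : R * R) :=
  (`|h * r.1%:R - (u.1 + C)| <= 2 * h) && (`|h * r.2%:R - (u.2 + C)| <= 2 * h).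

Lemma normP (u v : R * R) : `|u - v| < h -> `|u.1 - v.1| < h /\ `|u.2 - v.2| < h.
Proof. by rewrite prod_normE gt_max => /andP. Qed.

Lemma snap1_gt0 x : h <= x + C -> (0 < snap1 x)%N.
Proof. by move=> hx; rewrite truncn_gt0 ler_pdivlMr // mul1r. Qed.

(** The lattice path between the roundings of two points at distance less than
    h stays within 2h of the first of them. *)
Lemma snap_step u v : `|u - v| < h -> fits u -> fits v ->
  exists s, [/\ path lattice_adj (snap u) s, last (snap u) s = snap v &
    {in s, forall r, [/\ (0 < r.1)%N, (0 < r.2)%N & near_pt r u]}].
Proof.
move=> uv /andP[u1 u2] /andP[v1 v2]; have [uv1 uv2] := normP uv.
have vu1 : `|v.1 - u.1| < h by rewrite distrC.
have vu2 : `|v.2 - u.2| < h by rewrite distrC.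
have [||||s [ps ls ss]] := @stair (snap u) (snap v); rewrite /= ?snap1_close //.
exists s; split=> // r /ss /andP[r1 r2].
have le0 z : h <= z -> 0 <= z by apply: le_trans; exact: ltW.
split; last by rewrite /near_pt (snap1_near uv1) ?(snap1_near uv2) ?le0.
  by move: r1; rewrite !inE => /orP[] /eqP ->; exact: snap1_gt0.
by move: r2; rewrite !inE => /orP[] /eqP ->; exact: snap1_gt0.
Qed.

Lemma snap_near u : fits u -> [/\ (0 < (snap u).1)%N, (0 < (snap u).2)%N & near_pt (snap u) u].
Proof.
move=> /andP[u1 u2]; split; [exact: snap1_gt0|exact: snap1_gt0|].
have le0 z : h <= z -> 0 <= z by apply: le_trans; exact: ltW.
have uu (x : R) : `|x - x| < h by rewrite subrr normr0.
by rewrite /near_pt (snap1_near (uu _)) ?(snap1_near (uu _)) ?le0 ?inE ?eqxx.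
Qed.

Lemma near_close r u v : near_pt r u -> near_pt r v -> `|u - v| <= 4 * h.
Proof.
rewrite /near_pt prod_normE ge_max !ler_norml /=.
by move=> /andP[/andP[? ?] /andP[? ?]] /andP[/andP[? ?] /andP[? ?]]; apply/andP; split; lra.
Qed.

Lemma snap_chain f s ts : path (fun s t => `|f s - f t| < h) s ts ->
  {in s :: ts, forall t, fits (f t)} ->
  exists L, [/\ path lattice_adj (snap (f s)) L, last (snap (f s)) L = snap (f (last s ts)) &
    {in snap (f s) :: L, forall r, [/\ (0 < r.1)%N, (0 < r.2)%N &
        exists2 t, t \in s :: ts & near_pt r (f t)]}].
Proof.
elim: ts s => [|t ts IH] s /=.
  move=> _ fit; exists [::]; split=> // r; rewrite inE => /eqP ->.
  have [|r1 r2 r3] := @snap_near (f s); first by apply: fit; rewrite mem_head.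
  by split=> //; exists s; rewrite ?mem_head.
case/andP=> st pts fit.
have fs : fits (f s) by apply: fit; rewrite mem_head.
have ft : fits (f t) by apply: fit; rewrite !inE eqxx orbT.
have [|L [pL lL HL]] := IH t pts; first by move=> z zt; apply: fit; rewrite inE zt orbT.
have [s1 [p1 l1 H1]] := snap_step st fs ft.
exists (s1 ++ L); rewrite cat_path p1 l1 last_cat l1; split=> // r.
rewrite inE mem_cat => /or3P[/eqP ->|/H1[r1 r2 r3]|rL].
- by have [r1 r2 r3] := snap_near fs; split=> //; exists s; rewrite ?mem_head.
- by split=> //; exists s; rewrite ?mem_head.
have [|r1 r2 [z zt r3]] := HL r; first by rewrite inE rL orbT.
by split=> //; exists z; rewrite // inE zt orbT.
Qed.

End Lattice.

Lemma bounded_seq (s : seq (R * R)) : exists B : R,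
  {in s, forall u, - B <= u.1 /\ - B <= u.2}.
Proof.
elim: s => [|u s [B HB]]; first by exists 0.
pose M := Num.max B (`|u.1| + `|u.2|).
have M1 : B <= M by rewrite le_max lexx.
have M2 : `|u.1| + `|u.2| <= M by rewrite le_max lexx orbT.
exists M => v; rewrite inE => /orP[/eqP ->|/HB[H1 H2]]; last by split; lra.
have := normr_ge0 u.1; have := normr_ge0 u.2.
have := lerNnormlW (lexx `|u.1|); have := lerNnormlW (lexx `|u.2|).
by move=> *; split; lra.
Qed.

Lemma bounded_pts (s : seq pt) : exists n : nat,
  {in s, forall q, (q.1 <= n)%N && (q.2 <= n)%N}.
Proof.
elim: s => [|u s [B HB]]; first by exists 0%N.
exists (maxn B (u.1 + u.2)) => v; rewrite inE => /orP[/eqP ->|/HB]; lia.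
Qed.

(** Follow each arc by a chain of steps smaller than a fifth of a common lower
    bound for the distances between disjoint arcs, round the points of the chains to a lattice
    of that mesh and join them by stairs.  A lattice point on the paths of two
    arcs brings them within four fifths of that bound. *)
Lemma arcs_on_lattice (K : finType) (a : K -> R -> R * R) : (forall k, arc (a k)) ->
  exists (lat : R * R -> pt) (n : nat) (L : K -> seq pt),
  [/\ forall k, path lattice_adj (lat (a k 0)) (L k),
      forall k, last (lat (a k 0)) (L k) = lat (a k 1),
      forall k q, q \in lat (a k 0) :: L k -> (0 < q.1 <= n)%N && (0 < q.2 <= n)%N &
      forall k k' q, q \in lat (a k 0) :: L k -> q \in lat (a k' 0) :: L k' ->
        exists s t, [/\ s \in `[0, 1], t \in `[0, 1] & a k s = a k' t]].
Proof.
move=> ca; pose meet k k' := exists s t : R, [/\ s \in `[0, 1], t \in `[0, 1] & a k s = a k' t].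
have sep (p : K * K) : exists d : R, 0 < d /\ (meet p.1 p.2 \/
    forall s t : R, s \in `[0, 1] -> t \in `[0, 1] -> d <= `|a p.1 s - a p.2 t|).
  have [m|[d d0 H]] := arcs_separated (ca p.1) (ca p.2); first by exists 1; split=> //; left.
  by exists d; split=> //; right.
have [d dP] := fin_all_exists sep.
(* A fifth leaves room for twice the error 2h of rounding. *)
pose dm := \big[Num.min/1]_p d p; pose h := dm / 5.
have dm0 : 0 < dm by apply: lt_bigmin => // p _; have [] := dP p.
have h0 : 0 < h by rewrite /h; lra.
have [ts tsP] := fin_all_exists (fun k => arc_chain (ca k) h0).
have [B HB] := bounded_seq [seq a k t | k <- enum K, t <- 0 :: ts k].
pose C := B + h.
have fit k t : t \in 0 :: ts k -> fits h C (a k t).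
  move=> tk; have [|H1 H2] := HB (a k t).
    by apply/allpairsPdep; exists k, t; rewrite mem_enum.
  by rewrite /fits /C; apply/andP; split; lra.
have chains k : exists L, [/\ path lattice_adj (snap h C (a k 0)) L, last (snap h C (a k 0)) L = snap h C (a k 1) &
    {in snap h C (a k 0) :: L, forall r, [/\ (0 < r.1)%N, (0 < r.2)%N &
        exists2 t, t \in `[0, 1] & near_pt h C r (a k t)]}].
  have [p l I] := tsP k; have [|L [pL lL HL]] := @snap_chain h C h0 (a k) 0 (ts k) p;
    first by move=> t; exact: fit.
  exists L; rewrite l in lL; split=> // r /HL[r1 r2 [t /I tI rt]]; split=> //.
  by exists t.
have [L LP] := fin_all_exists chains.
have [n nP] := bounded_pts [seq q | k <- enum K, q <- snap h C (a k 0) :: L k].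
exists (snap h C), n, L; split=> [k|k|k q qk|k k' q qk qk']; try by have [] := LP k.
  have [_ _ LH] := LP k; have [q1 q2 _] := LH q qk; rewrite q1 q2 /=.
  by apply: nP; apply/allpairsPdep; exists k, q; rewrite mem_enum.
have [_ _ LH] := LP k; have [_ _ [s sI sq]] := LH q qk.
have [_ _ LH'] := LP k'; have [_ _ [t tI tq]] := LH' q qk'.
have [_ [//|/(_ s t sI tI)]] := dP (k, k').
have := near_close sq tq; have : dm <= d (k, k') by exact: bigmin_le.
rewrite /h /= => H1 H2 H3; have := le_trans H1 (le_trans H3 H2); lra.
Qed.

End Arcs.

(** * Plane drawings have abstract duals *)

Lemma simple_edge_set (G : sgraph) : simple (edge_set G).
Proof.
move=> e /imsetP[[x y] /= xy ->]; rewrite cards2.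
have [xyE|//] := eqVneq x y; move: xy; rewrite inE /= xyE.
by rewrite adj_irrefl.
Qed.

Lemma simple_sub (T : finType) (S S' : {set {set T}}) : simple S -> S' \subset S -> simple S'.
Proof. by move=> sS /subsetP sub e /sub /sS. Qed.

Section Drawing.
Import all_order all_algebra lra.
Import boolp classical_sets prodnormedzmodule topology normedtype.
Import Order.TTheory GRing.Theory Num.Theory numFieldNormedType.Exports.
Local Open Scope classical_set_scope.
Local Open Scope ring_scope.
Variable R : realType.
Notation arc f := {within `[0%R, 1%R], continuous f}.

Lemma arc_contract (f : R -> R * R) (phi : R -> R) : arc f ->
  (forall s, s \in `[0, 1] -> phi s \in `[0, 1]) ->
  (forall s t, `|phi s - phi t| <= `|s - t|) -> arc (f \o phi).
Proof.
move=> cf I lip; apply/subspace_continuousP => s sI; apply/cvgrPdist_lt => e e0.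
have [d d0 H] := arc_near cf (I s sI) e0.
exists d => //= t /= st tI; apply: H; first exact: I.
by rewrite distrC; apply: le_lt_trans (lip _ _) st.
Qed.

(** The parts of an arc, each of them parametrized by [0, 1].  The last part runs
    backwards, so that the first and last ones start at a vertex. *)
Definition third (i : 'I_3) (t : R) : R :=
  if i == 0 :> nat then t / 3 else if i == 1 :> nat then (1 + t) / 3 else 1 - t / 3.

Lemma arc_third (f : R -> R * R) i : arc f -> arc (f \o third i).
Proof.
move=> cf; apply: arc_contract => // [s|s t].
  rewrite /third !in_itv /= => /andP[s0 s1]; case: ifP => _; first by apply/andP; split; lra.
  by case: ifP => _; apply/andP; split; lra.
have third_ge0 (x : R) : `|x / 3| = `|x| / 3.
  by rewrite normrM; congr (_ * _); rewrite ger0_norm // invr_ge0.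
have : `|third i s - third i t| = `|s - t| / 3.
  rewrite /third; case: ifP => _; first by rewrite -third_ge0; congr `|_|; lra.
  case: ifP => _; first by rewrite -third_ge0; congr `|_|; lra.
  by rewrite (distrC s) -third_ge0; congr `|_|; lra.
by have := normr_ge0 (s - t); lra.
Qed.

Section PlaneGraph.
Variables (G : sgraph) (p : G -> R * R) (g : edge G -> R -> R * R).
Hypothesis D : plane_drawing p g.
Variable ends : edge G -> G * G.
Hypothesis endsP : forall e, [/\ val e = [set (ends e).1; (ends e).2]%SET,
  g e 0 = p (ends e).1 & g e 1 = p (ends e).2].

Definition at_vertex e (t : R) v := (t = 0 /\ v = (ends e).1) \/ (t = 1 /\ v = (ends e).2).

Lemma arcs_meet e e' t t' : t \in `[0, 1] -> t' \in `[0, 1] -> g e t = g e' t' ->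
  (e = e' /\ t = t') \/ exists v, at_vertex e t v /\ at_vertex e' t' v.
Proof.
have cases e0 t0 : t0 \in `[0, 1] -> (t0 \in `]0, 1[) \/
    exists v, at_vertex e0 t0 v /\ g e0 t0 = p v.
  have [_ g0 g1] := endsP e0; rewrite !in_itv /= => /andP[].
  rewrite le_eqVlt => /orP[/eqP <- _|t0P].
    by right; exists (ends e0).1; split=> //; left.
  rewrite le_eqVlt => /orP[/eqP ->|t1P]; last by left; rewrite t0P.
  by right; exists (ends e0).2; split=> //; right.
move=> tI tI' E; case: (cases e t tI) (cases e' t' tI') => [ti|[v [tv gv]]] [ti'|[v' [tv' gv']]].
- have [ee|ee] := eqVneq e e'.
    subst e'; left; split=> //; exact: (drawing_arc_inj D) E.
  by case: (drawing_arc_disjoint D ee ti ti').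
- by case: (drawing_arc_vertex D ti (e := e) (x := v')); rewrite E gv'.
- by case: (drawing_arc_vertex D ti' (e := e') (x := v)); rewrite -E gv.
right; exists v; split=> //; suff -> : v = v' by [].
by apply: (drawing_vertex_inj D); rewrite -gv -gv'.
Qed.

End PlaneGraph.

(** The first and last parts of the arcs are the near parts at their ends; parts
    of distinct edges meet only if both are near parts at the same vertex. *)
Theorem planar_dual (G : sgraph) (S : {set {set G}}) : planar R G -> (S \subset edge_set G)%SET ->
  exists (F : finType) (s1 s2 : {set G} -> F), dual S s1 s2.
Proof.
move=> [p [g D]] /fintype.subsetP SE; have [->|/finset.set0Pn[e0 e0S]] := eqVneq S finset.set0.
  exists unit, (fun=> tt), (fun=> tt) => z; split=> _; first by exists (fun=> true) => e; rewrite finset.in_set0.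
  by move=> v; rewrite /odd_at big_pred0 // => e; rewrite finset.in_set0.
have endsE (e : edge G) : exists xy : G * G, [/\ val e = [set xy.1; xy.2]%SET,
    g e 0 = p xy.1 & g e 1 = p xy.2].
  by have [x [y H]] := drawing_arc_ends D e; exists (x, y).
have [ends endsP] := fin_all_exists endsE.
pose E (e : {set G}) : edge G := insubd (Sub e0 (SE _ e0S) : edge G) e.
have EK e : e \in S -> val (E e) = e by move=> eS; rewrite insubdK //; exact: (SE e eS).
pose eu e := (ends (E e)).1; pose ev e := (ends (E e)).2.
pose a (k : edge G * 'I_3) := g k.1 \o third k.2.
have ca k : arc (a k) by apply: arc_third; exact: (drawing_arc_continuous D).
have [lat [n [L [Lpath Llast Lrange Lmeet]]]] := arcs_on_lattice ca.
pose i1 : 'I_3 := inord 1; pose i2 : 'I_3 := inord 2.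
have third0 t : third ord0 t = t / 3 by [].
have third1 t : third i1 t = (1 + t) / 3 by rewrite /third /= inordK.
have third2 t : third i2 t = 1 - t / 3 by rewrite /third /= inordK.
have start e : a (E e, ord0) 0 = p (eu e).
  by rewrite /a /= third0 mul0r; have [] := endsP (E e).
have finish e : a (E e, i2) 0 = p (ev e).
  by rewrite /a /= third2 mul0r subr0; have [] := endsP (E e).
(* The parts of an arc fit together at the times 1/3 and 2/3. *)
have glue1 e : a (E e, i1) 0 = a (E e, ord0) 1 by rewrite /a /= third0 third1 addr0.
have glue2 e : a (E e, i1) 1 = a (E e, i2) 1.
  by rewrite /a /= third1 third2; congr (g _ _); lra.
have LP1 e : path lattice_adj (lat (p (eu e))) (L (E e, ord0)) by rewrite -start.
have meet e e' i j q : q \in lat (a (e, i) 0) :: L (e, i) -> q \in lat (a (e', j) 0) :: L (e', j) ->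
    exists s t : R, [/\ 0 <= s <= 1, 0 <= t <= 1 & (e = e' /\ third i s = third j t) \/
      exists v, at_vertex ends e (third i s) v /\ at_vertex ends e' (third j t) v].
  move=> H1 H2; have [s [t [sI tI E0]]] := Lmeet _ _ _ H1 H2.
  exists s, t; move: (sI) (tI); rewrite !in_itv /= => sI' tI'; split=> //.
  have I3 k x : 0 <= x <= 1 -> third k x \in `[0, 1].
    rewrite /third in_itv /= => /andP[x0 x1]; case: ifP => _; first by apply/andP; split; lra.
    by case: ifP => _; apply/andP; split; lra.
  by apply: (arcs_meet D endsP) E0; exact: I3.
have inj e e' : e \in S -> e' \in S -> E e = E e' -> e = e'.
  by move=> eS e'S EE; rewrite -(EK e eS) -(EK e' e'S) EE.
have first_lt1 (x : R) : x <= 1 -> x / 3 = 1 -> False by clear; lra.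
have middle_gt0 (x : R) : 0 <= x -> (1 + x) / 3 = 0 -> False by clear; lra.
have middle_lt1 (x : R) : x <= 1 -> (1 + x) / 3 = 1 -> False by clear; lra.
have last_gt0 (x : R) : x <= 1 -> 1 - x / 3 = 0 -> False by clear; lra.
have first_lt_last (x y : R) : x <= 1 -> y <= 1 -> x / 3 = 1 - y / 3 -> False by clear; lra.
apply: (@arcs_dual G S n (fun v => lat (p v)) eu ev (fun e => L (E e, ord0))
   (fun e => L (E e, i2)) (fun e => L (E e, i1))).
- move=> e eS; have [eE _ _] := endsP (E e); rewrite EK // in eE; split=> //.
  apply/eqP => ee; have := simple_edge_set (SE _ eS); rewrite {1}eE.
  by rewrite -/(eu e) -/(ev e) ee finset.setUid cards1.
- by move=> e eS; exact: LP1.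
- by move=> e eS; rewrite -finish.
- by move=> e eS; rewrite -start Llast -glue1.
- by move=> e eS; rewrite -start Llast -glue1 Llast glue2 -finish Llast.
- move=> e q eS; rewrite !mem_cat -finish -start Llast -glue1.
  by case/or3P => /Lrange.
- move=> e e' q eS e'S; rewrite -!start => q1 q2.
  have [s [t [/andP[s0 s1] /andP[t0 t1] H]]] := meet _ _ _ _ _ q1 q2; move: H; rewrite !third0.
  case=> [[EE _]|[v [[[_ H1]|[/(first_lt1 _ s1)//]]]]]; first by rewrite /eu EE.
  by case=> [[_ H2]|[/(first_lt1 _ t1)//]]; rewrite /eu -H1.
- move=> e e' q eS e'S; rewrite -start -finish => q1 q2.
  have [s [t [/andP[s0 s1] /andP[t0 t1] H]]] := meet _ _ _ _ _ q1 q2; move: H; rewrite third0 third2.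
  case=> [[_ /(first_lt_last _ _ s1 t1)//]|[v [[[_ H1]|[H1 _]]]]]; last by case: (first_lt1 _ s1 H1).
  by case=> [[/(last_gt0 _ t1)//]|[_ H2]]; rewrite /eu -H1.
- move=> e e' q eS e'S; rewrite -!finish => q1 q2.
  have [s [t [/andP[s0 s1] /andP[t0 t1] H]]] := meet _ _ _ _ _ q1 q2; move: H; rewrite !third2.
  case=> [[EE _]|[v [[[/(last_gt0 _ s1)//]|[_ H1]]]]]; first by rewrite /ev EE.
  by case=> [[/(last_gt0 _ t1)//]|[_ H2]]; rewrite /ev -H1.
- move=> e e' q eS e'S; rewrite -!start Llast -glue1 => q1 q2.
  have [s [t [/andP[s0 s1] /andP[t0 t1] H]]] := meet _ _ _ _ _ q1 q2; move: H; rewrite third1.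
  by case=> [[EE _]|[v [[[/(middle_gt0 _ s0)//]|[/(middle_lt1 _ s1)//]]]]]; exact: inj.
- move=> e e' q eS e'S; rewrite -start -finish Llast -glue1 => q1 q2.
  have [s [t [/andP[s0 s1] /andP[t0 t1] H]]] := meet _ _ _ _ _ q1 q2; move: H; rewrite third1.
  by case=> [[EE _]|[v [[[/(middle_gt0 _ s0)//]|[/(middle_lt1 _ s1)//]]]]]; exact: inj.
- move=> e e' q eS e'S; rewrite -!start !Llast -!glue1 => q1 q2.
  have [s [t [/andP[s0 s1] /andP[t0 t1] H]]] := meet _ _ _ _ _ q1 q2; move: H; rewrite third1.
  by case=> [[EE _]|[v [[[/(middle_gt0 _ s0)//]|[/(middle_lt1 _ s1)//]]]]]; exact: inj.
Qed.

End Drawing.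

(** * Greedy group colourings and the theorem *)

Section Greedy.
Import all_algebra finmap boolp classical_sets cardinality.
Import GRing.Theory.
Local Open Scope classical_set_scope.
Local Open Scope card_scope.

Lemma list_avoid (A : choiceType) (B : set A) k (s : seq A) :
  B #= `I_k -> size s < k -> exists2 a, B a & a \notin s.
Proof.
move=> cB sk; have finB : finite_set B by apply/finite_setP; exists k.
apply: contrapT => N; move: sk; rewrite ltnNge -(card_fset_set cB) => /negP; apply.
apply: uniq_leq_size; first exact: fset_uniq.
move=> a; rewrite in_fset_set // inE => Ba; apply: contrapT => /negP as_.
by apply: N; exists a.
Qed.

(** Remove a vertex v with fewer than k neighbours, colour the rest, and give v
    a colour that avoids the one value that each neighbour forbids. *)
Lemma degenerate_group_choosable (H : sgraph) k :
  (forall W : {set H}, W != finset.set0 ->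
     exists2 v, v \in W & #|[set u in W | adj v u]%SET| < k) ->
  group_choosable H k.
Proof.
move=> light A _ L cardL o [oadj oN] f.
have irr x : o x x = false.
  by apply/negbTE; have := oadj x x; rewrite adj_irrefl orbb => <-.
suff colW (W : {set H}) : exists c : H -> A, (forall v, L v (c v)) /\
    (forall (e : edge H) x y, x \in W -> y \in W ->
       val e = [set x; y]%SET -> o x y -> (c x - c y)%R <> f e).
  have [c [cL cP]] := colW finset.setT.
  by exists c; split=> // e x y; apply: cP; rewrite finset.in_setT.
move En : #|W| => n; elim: n W En => [|n IH] W cW.
  have Lne v : exists a, L v a.
    have [|u _ uk] := light [set v]%SET; first by apply/finset.set0Pn; exists v; rewrite finset.set11.
    by have [|a La _] := @list_avoid _ _ _ [::] (cardL v); [exact: leq_ltn_trans uk|exists a].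
  have [c cL] := choice Lne; exists c; split=> // e x y xW.
  by rewrite (finset.cards0_eq cW) finset.in_set0 in xW.
have [|v vW vk] := light W; first by rewrite -finset.card_gt0 cW.
have [|c [cL cP]] := IH (W :\ v)%SET.
  by move: cW; rewrite (finset.cardsD1 v) vW => -[].
(* The colour of v that the colour of u forbids. *)
pose bad u : A := if insub [set v; u]%SET is Some e
  then if o v u then (f e + c u)%R else (c u - f e)%R else 0%R.
have [|a La aN] := @list_avoid _ _ _ [seq bad u | u <- enum [set u in W | adj v u]%SET] (cardL v).
  by rewrite size_map -cardE.
have aP (e : edge H) u : val e = [set v; u]%SET -> u \in W -> adj v u ->
    a <> if o v u then (f e + c u)%R else (c u - f e)%R.
  move=> eE uW vu aE; case/negP: aN; apply/mapP; exists u.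
    by rewrite mem_enum finset.inE uW.
  by rewrite /bad -eE valK.
exists (fun u => if u == v then a else c u); split=> [u|e x y xW yW].
  by case: eqP => [->|_].
have [->|xv] := eqVneq x v; have [->|yv] := eqVneq y v.
- by rewrite irr.
- move=> eE vy; have vyE : adj v y by rewrite oadj vy.
  by move=> E; apply: (aP e y) => //; rewrite vy -E subrK.
- move=> eE ov; have vx : adj v x by rewrite oadj ov orbT.
  have eE' : val e = [set v; x]%SET by rewrite finset.setUC.
  have /negbTE ovx : ~~ o v x by have := oN x v; rewrite ov.
  by move=> E; apply: (aP e x) => //; rewrite ovx -E opprB addrC subrK.
- by move=> eE oxy; apply: cP => //; rewrite finset.in_setD1 ?xv ?yv.
Qed.

End Greedy.

Lemma edge_adj (G : sgraph) (x y : G) : [set x; y] \in edge_set G -> adj x y.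
Proof.
case/imsetP=> -[a b] /= ab /eqP; rewrite pair_eqE; rewrite inE /= in ab.
by case/orP=> /andP[/eqP -> /eqP ->] //; rewrite adj_sym.
Qed.

Lemma deg_le_max_degree (G : sgraph) (S : {set {set G}}) v :
  S \subset edge_set G -> deg S v <= max_degree G.
Proof.
move=> /subsetP sub; apply: leq_trans (leq_bigmax v).
have sS : simple S by move=> e /sub; exact: simple_edge_set.
have /subset_leq_card : [set e in S | v \in e] \subset
    [set [set v; y] | y in [pred y | adj v y]].
  apply/subsetP => e; rewrite inE => /andP[eS ve].
  have [u _ eE] := edge_end sS eS ve; apply/imsetP; exists u => //.
  by rewrite inE; apply: edge_adj; rewrite -eE sub.
by move/leq_trans; apply; exact: leq_imset_card.
Qed.

Theorem theorem3p13 (R : realType) (G : sgraph)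
  (planarG : planar R G)
  (degG : 7 <= max_degree G)
  (noC5 : forall s : seq G, size s = 5 -> ~ ucycle adj s) :
  chi'_gl G <= max_degree G + 1.
Proof.
rewrite /chi'_gl /chi_gl; case: ex_minnP => m _; apply; apply/boolp.asboolP.
apply: degenerate_group_choosable => W /set0Pn[e0 e0W].
pose S : {set {set G}} := [set val e | e in W].
have SP f : f \in W -> val f \in S by exact: imset_f.
have sub : S \subset edge_set G.
  by apply/subsetP => _ /imsetP[e _ ->]; exact: (valP e).
have sS : simple S by apply: simple_sub sub; exact: simple_edge_set.
have [|S' S'S|a x p q r U ax xp pq qr ra|u [v [uvS d]]] :=
    light_edge sS _ degG (fun v => deg_le_max_degree v sub).
- by apply/set0Pn; exists (val e0); apply: imset_f.
- exact: (planar_dual planarG (subset_trans S'S sub)).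
- have E y z : [set y; z] \in S -> adj y z by move/(subsetP sub)/edge_adj.
  by apply: (noC5 [:: a; x; p; q; r]); rewrite //= /ucycle /= !E //.
have /imsetP[e eW eE] := uvS; exists e => //; clearbody S.
have star y : y \in [set u; v] -> #|[set f in S | y \in f] :\ val e| = (deg S y).-1.
  by move=> ye; rewrite /deg [in RHS](cardsD1 (val e)) [in RHS]inE -eE uvS ye.
have dpos y : y \in [set u; v] -> 0 < deg S y.
  by move=> ye; apply/card_gt0P; exists [set u; v]; rewrite inE uvS.
rewrite addn1 ltnS -(card_imset _ val_inj).
apply: (@leq_trans ((deg S u).-1 + (deg S v).-1)); last first.
  have := dpos u (set21 _ _); have := dpos v (set22 _ _); move: d.
  by clear; lia.
rewrite -!star ?set21 ?set22 //; apply: leq_trans (leq_card_setU _ _).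
apply/subset_leq_card/subsetP => _ /imsetP[f fW ->]; move: fW.
rewrite inE => /andP[fW /andP[ef]]; rewrite disjoint_sym => /pred0Pn[z /andP[/= zf ze]].
have fe : val f != val e by rewrite (inj_eq val_inj) eq_sym.
have fS := SP f fW.
rewrite in_setU !in_setD1 fe !inE fS /=.
by move: ze; rewrite -eE !inE => /orP[] /eqP <-; rewrite zf ?orbT.
Qed.
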